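(* Let $m \in \mathbb{N}$ and let $k \geq K_m$, where $$K_m = \left\lceil \frac{20}{19}\left( \log_{1.999}(m+2) + 24 \right) + 4 \right\rceil.$$ If $q$ satisfies $|q - q_k| < q_k^{-(m+2)k-3}$, then $q \in \mathcal{B}_{m+2}$ and $$\dim_{\mathrm{H}}\big(\mathcal{U}_q^{(m+2)}\big) \geq 1 - 1024(m+2)^{\frac{20}{19}}q^{4-k} > 0.$$
   Context: For $q \in (1,2)$ let $I_q = [0, \frac{1}{q-1}]$. A sequence $(\epsilon_j)_{j\ge1} \in \{0,1\}^\mathbb{N}$ is a base $q$ expansion of $x$ if $x = \sum_{j\ge1} \epsilon_j q^{-j}$; let $\Sigma_q(x)$ be the set of base $q$ expansions of $x$. For $m \geq 2$, $\mathcal{U}_q^{(m)} = \{x \in I_q : |\Sigma_q(x)| = m\}$, and $\mathcal{B}_m = \{q \in (1,2) : \mathcal{U}_q^{(m)} \neq \emptyset\}$. For $k \geq 2$, the $k$-Bonacci number $q_k$ is the unique root in $(1,2)$ of $x^k - x^{k-1} - \cdots - x - 1 = 0$. $\dim_{\mathrm{H}}$ denotes Hausdorff dimension. *)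

(* Defs.v *)
From Stdlib Require Import Reals Lra List.
From Coquelicot Require Import Coquelicot.
Open Scope R_scope.

(** Base-q expansions.  A sequence (eps_j)_{j>=1} is encoded as
    e : nat -> bool with e j = eps_{j+1}. *)
Definition digit (b : bool) : R := if b then 1 else 0.

Definition is_expansion (q x : R) (e : nat -> bool) : Prop :=
  is_series (fun j : nat => digit (e j) / q ^ (S j)) x.

Definition I_q (q x : R) : Prop := 0 <= x <= 1 / (q - 1).

Definition num_expansions_eq (q x : R) (n : nat) : Prop :=
  exists l : list (nat -> bool),
    length l = n /\ NoDup l /\ (forall e, is_expansion q x e <-> In e l).

Definition U_q (q : R) (m : nat) : R -> Prop :=
  fun x => I_q q x /\ num_expansions_eq q x m.

Definition in_B (m : nat) (q : R) : Prop :=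
  1 < q < 2 /\ exists x, U_q q m x.

(** q is the k-Bonacci number: the root in (1,2) of
    x^k - x^{k-1} - ... - x - 1 = 0  (for k >= 2 it is unique). *)
Definition is_k_bonacci (k : nat) (q : R) : Prop :=
  1 < q < 2 /\ q ^ k = sum_f_R0 (fun i => q ^ i) (k - 1).

Definition diam (A : R -> Prop) : R :=
  real (Lub_Rbar (fun r => exists x y, A x /\ A y /\ r = Rabs (x - y))).

Definition spow (d s : R) : R := if Rle_dec d 0 then 0 else Rpower d s.

Definition delta_cover (delta : R) (A : R -> Prop) (U : nat -> R -> Prop) : Prop :=
  (forall x, A x -> exists n, U n x) /\
  (forall n x y, U n x -> U n y -> Rabs (x - y) <= delta).

Definition cover_sum (s : R) (U : nat -> R -> Prop) : Rbar :=
  Lim_seq (fun N => sum_n (fun n => spow (diam (U n)) s) N).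

Definition hausdorff_delta (s delta : R) (A : R -> Prop) : Rbar :=
  Rbar_glb (fun v => exists U, delta_cover delta A U /\ cover_sum s U = v).

Definition hausdorff_measure (s : R) (A : R -> Prop) : Rbar :=
  Rbar_lub (fun v => exists delta, 0 < delta /\ v = hausdorff_delta s delta A).

(** dim_H(A) = inf { s > 0 : H^s(A) = 0 }  (= inf {s >= 0 : H^s(A) = 0}) *)
Definition hausdorff_dim (A : R -> Prop) : Rbar :=
  Rbar_glb (fun v => exists s, 0 < s /\ v = Finite s /\
                               hausdorff_measure s A = Finite 0).

(** K_m = ceil( 20/19 (log_{1.999}(m+2) + 24) + 4 ), as a real before ceiling *)
Definition K_real (m : nat) : R :=
  20 / 19 * (ln (INR m + 2) / ln (1999 / 1000) + 24) + 4.

(* Main.v *)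
Require Import Defs.
From Stdlib Require Import Reals Lra List.
From Stdlib Require Import Arith Lia FinFun ClassicalEpsilon FunctionalExtensionality.
From Coquelicot Require Import Coquelicot.
Open Scope R_scope.

(** In base [q_k] the words [1 0^k] and [0 1^k] have the same value, so [1 0^((m+1)k) z] has [m+2] expansions as soon as [z] has only one.  For [q] close to [q_k] the [m+2] rewritings produce slightly shifted tails [z + t_i], and it remains to find many [z] such that every [z + t_i] has a unique expansion, i.e. an orbit under the expanding map that never meets the switch region.

    The switch region is enlarged to a hole of length about [q^-k] whose left end is the value of [0 1^(k-1)].  The points first falling into the hole at time [j] then form clusters of diameter [O(q^(-k-j))] that are at distance at least [q^-j/8] from each other.

    Let [S] be the set of points whose [m+2] translates all avoid the clusters, and [s = 1 - 1024 (m+2)^(20/19) q^(4-k)].  Given a cover of [S] with small [s]-dimensional sum, a point of [S] outside the cover is found by descending a dyadic tree: to each dyadic interval [I] attach the [s]-dimensional sum of the dyadic intervals inside [I] that meet the cover, plus that of those inside [I] that meet clusters of their own size and have at least [2^-p |I|] as length, with [2^-p] of order [q^-k].  As long as this potential is less than [|I|^s], one of the two halves of [I] inherits the property, since the new clusters contribute at most [O((m+2) q^-k |I|^s)] while subdivision gains a factor [2^(1-s)]. *)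

(** * Dyadic trees *)

Definition indicator (P : Prop) : R := if excluded_middle_informative P then 1 else 0.

Lemma indicator_true (P : Prop) : P -> indicator P = 1.
Proof. intros H; unfold indicator; destruct excluded_middle_informative; tauto. Qed.

Lemma indicator_false (P : Prop) : ~ P -> indicator P = 0.
Proof. intros H; unfold indicator; destruct excluded_middle_informative; tauto. Qed.

Lemma indicator_bound (P : Prop) : 0 <= indicator P <= 1.
Proof. unfold indicator; destruct excluded_middle_informative; lra. Qed.

Fixpoint count (P : nat -> Prop) (lo len : nat) : R :=
  match len with
  | O => 0
  | S l => indicator (P lo) + count P (S lo) l
  end.

Lemma count_nonneg P len lo : 0 <= count P lo len.
Proof.
  revert lo; induction len as [|l IH]; intros lo; simpl; [lra|].
  generalize (indicator_bound (P lo)) (IH (S lo)); lra.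
Qed.

Lemma count_add P l1 l2 lo : count P lo (l1 + l2) = count P lo l1 + count P (lo + l1) l2.
Proof.
  revert lo; induction l1 as [|l IH]; intros lo; simpl.
  - rewrite Nat.add_0_r; ring.
  - rewrite IH. replace (lo + S l)%nat with (S lo + l)%nat by lia. ring.
Qed.

Lemma count_bound P len lo d :
  (forall x, (lo <= x < lo + len)%nat -> P x -> (x < lo + d)%nat) ->
  count P lo len <= INR d.
Proof.
  revert lo d; induction len as [|l IH]; intros lo d H.
  - apply pos_INR.
  - simpl count. destruct d as [|d].
    + rewrite indicator_false.
      * rewrite Rplus_0_l; apply IH.
        intros x Hx Px; specialize (H x ltac:(lia) Px); lia.
      * intros Px; specialize (H lo ltac:(lia) Px); lia.
    + rewrite S_INR.
      assert (count P (S lo) l <= INR d)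
        by (apply IH; intros x Hx Px; specialize (H x ltac:(lia) Px); lia).
      generalize (indicator_bound (P lo)); lra.
Qed.

Lemma count_zero P len lo :
  (forall x, (lo <= x < lo + len)%nat -> ~ P x) -> count P lo len = 0.
Proof.
  intros H; apply Rle_antisym; [|apply count_nonneg].
  change 0 with (INR 0); apply count_bound; intros x Hx Px; now destruct (H x Hx).
Qed.

(** Counted from the first marked index, every other one is at distance at most 2. *)
Lemma count_clustered P len lo :
  (forall x x', (lo <= x < lo + len)%nat -> (lo <= x' < lo + len)%nat ->
     P x -> P x' -> (x' <= x + 2)%nat) ->
  count P lo len <= 3.
Proof.
  revert lo; induction len as [|l IH]; intros lo H; [simpl; lra|].
  destruct (excluded_middle_informative (P lo)) as [Plo|Plo].
  - replace 3 with (INR 3) by (simpl; lra).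
    apply count_bound; intros x Hx Px.
    specialize (H lo x ltac:(lia) Hx Plo Px); lia.
  - simpl count; rewrite indicator_false by assumption; rewrite Rplus_0_l.
    apply IH; intros x x' Hx Hx'; apply H; lia.
Qed.

Lemma count_or P P1 P2 len lo :
  (forall x, P x -> P1 x \/ P2 x) -> count P lo len <= count P1 lo len + count P2 lo len.
Proof.
  intros H; revert lo; induction len as [|l IH]; intros lo; simpl; [lra|].
  specialize (IH (S lo)).
  generalize (indicator_bound (P lo)) (indicator_bound (P1 lo)) (indicator_bound (P2 lo)); intros.
  destruct (excluded_middle_informative (P lo)) as [Hl|Hl].
  - destruct (H lo Hl) as [H'|H']; rewrite (indicator_true _ H'); lra.
  - rewrite (indicator_false _ Hl); lra.
Qed.

Lemma count_union P (T : nat -> nat -> Prop) n C len lo :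
  (forall x, P x -> exists r, (r < n)%nat /\ T r x) ->
  (forall r, (r < n)%nat -> count (T r) lo len <= C) ->
  count P lo len <= INR n * C.
Proof.
  revert P; induction n as [|n IH]; intros P H HC.
  - rewrite count_zero; [simpl; lra|].
    intros x _ Px; destruct (H x Px) as [r [Hr _]]; lia.
  - rewrite S_INR, Rmult_plus_distr_r, Rmult_1_l.
    eapply Rle_trans; [apply (count_or P (fun x => exists r, (r < n)%nat /\ T r x) (T n))|].
    + intros x Px; destruct (H x Px) as [r [Hr Tr]].
      destruct (Nat.eq_dec r n) as [->|]; [now right|left; exists r; split; [lia|easy]].
    + apply Rplus_le_compat; [apply IH|apply HC; lia].
      * easy.
      * intros r Hr; apply HC; lia.
Qed.

Lemma half_pow_pos a : 0 < (/2) ^ a.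
Proof. apply pow_lt; lra. Qed.

Lemma half_pow_antitone a b : (/2) ^ a < (/2) ^ b -> (b < a)%nat.
Proof.
  intros H; destruct (le_lt_dec a b) as [Hab|]; [|easy].
  replace b with (a + (b - a))%nat in H by lia; rewrite pow_add in H.
  assert ((/2) ^ (b - a) <= 1) by
    (rewrite <- (pow1 (b - a)); apply pow_incr; lra).
  generalize (half_pow_pos a); nra.
Qed.

Lemma dyadic_scale r : 0 < r <= 1 -> exists g, (/2) ^ S g < r <= (/2) ^ g.
Proof.
  intros [Hr Hr1].
  destruct (pow_lt_1_zero (/2) ltac:(rewrite Rabs_right; lra) r Hr) as [M HM].
  specialize (HM M (le_n M)).
  rewrite Rabs_right in HM by (left; apply half_pow_pos).
  clear Hr; induction M as [|M IH]; [simpl in HM; lra|].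
  destruct (Rlt_le_dec ((/2) ^ M) r); [now apply IH|].
  exists M; lra.
Qed.

Lemma half_pow_shift a l : (/2) ^ a = 2 ^ l * (/2) ^ (a + l).
Proof.
  rewrite pow_add; transitivity ((/2) ^ a * (2 * /2) ^ l).
  - replace (2 * /2) with 1 by lra; rewrite pow1; ring.
  - rewrite Rpow_mult_distr; ring.
Qed.

(** The interval is closed so that a nested branch has a common point. Neighbours share an endpoint,
    so a set of diameter at most [2^-a] may meet three nodes of generation [a]. *)
Definition node (a y : nat) (t : R) : Prop :=
  INR y * (/2) ^ a <= t <= (INR y + 1) * (/2) ^ a.

Lemma node_sub a l y x t :
  (y * 2 ^ l <= x < y * 2 ^ l + 2 ^ l)%nat -> node (a + l) x t -> node a y t.
Proof.
  intros [H1 H2] [H3 H4].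
  assert (E : (/2) ^ a = INR (2 ^ l) * (/2) ^ (a + l)).
  { rewrite pow_INR; apply half_pow_shift. }
  apply le_INR in H1; rewrite mult_INR in H1.
  assert (H2' : (S x <= y * 2 ^ l + 2 ^ l)%nat) by lia.
  apply le_INR in H2'; rewrite S_INR, plus_INR, mult_INR in H2'.
  generalize (half_pow_pos (a + l)); intros Hp.
  unfold node; rewrite E; split.
  - apply Rle_trans with (2 := H3); rewrite <- Rmult_assoc.
    now apply Rmult_le_compat_r; [left|].
  - apply Rle_trans with (1 := H4); rewrite <- Rmult_assoc.
    apply Rmult_le_compat_r; [now left|lra].
Qed.

Lemma node_close b x x' t t' :
  node b x t -> node b x' t' -> Rabs (t' - t) <= (/2) ^ b -> (x' <= x + 2)%nat.
Proof.
  intros [_ H1] [H2 _] H; apply INR_le; rewrite plus_INR; simpl (INR 2).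
  apply Rmult_le_reg_r with (1 := half_pow_pos b).
  apply Rabs_le_between in H; lra.
Qed.

Lemma nested_nodes (y : nat -> nat) :
  y O = O -> (forall a, y (S a) = (2 * y a)%nat \/ y (S a) = (2 * y a + 1)%nat) ->
  exists t, forall a, node a (y a) t.
Proof.
  intros H0 HS.
  set (lo := fun a => INR (y a) * (/2) ^ a).
  set (hi := fun a => (INR (y a) + 1) * (/2) ^ a).
  assert (Hstep : forall a, lo a <= lo (S a) /\ hi (S a) <= hi a).
  { intros a; unfold lo, hi; simpl pow; generalize (half_pow_pos a); intros Hp.
    destruct (HS a) as [E|E]; rewrite E; rewrite ?plus_INR, mult_INR; simpl INR; nra. }
  assert (Hmono : forall a l, lo a <= lo (a + l)%nat /\ hi (a + l)%nat <= hi a).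
  { intros a l; induction l as [|l IH]; [rewrite Nat.add_0_r; lra|].
    rewrite Nat.add_succ_r; generalize (Hstep (a + l)%nat); lra. }
  assert (Hlh : forall a, lo a <= hi a)
    by (intros a; unfold lo, hi; generalize (half_pow_pos a); lra).
  assert (Hcross : forall a b, lo a <= hi b).
  { intros a b; generalize (Hmono a b) (Hmono b a) (Hlh (a + b)%nat).
    rewrite (Nat.add_comm b a); lra. }
  destruct (completeness (fun v => exists a, v = lo a)) as [t [Hub Hlub]].
  - exists (hi O); intros v [a ->]; apply Hcross.
  - exists (lo O), O; easy.
  - exists t; intros a; split.
    + apply Hub; now exists a.
    + apply Hlub; intros v [b ->]; apply Hcross.
Qed.

(** Whenever the left child is not below its threshold, the bound on the sum forces the right child
    below it. *)
Lemma greedy_branch (f : nat -> nat -> R) (w : nat -> R) :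
  f O O < w O ->
  (forall a y, f a y < w a -> f (S a) (2 * y)%nat + f (S a) (2 * y + 1)%nat < 2 * w (S a)) ->
  exists y : nat -> nat, y O = O /\
    (forall a, y (S a) = (2 * y a)%nat \/ y (S a) = (2 * y a + 1)%nat) /\
    (forall a, f a (y a) < w a).
Proof.
  intros H0 HS.
  set (y := fix y a := match a with
            | O => O
            | S a' => if Rlt_dec (f (S a') (2 * y a')%nat) (w (S a'))
                      then (2 * y a')%nat else (2 * y a' + 1)%nat
            end).
  exists y; split; [easy|split].
  - intros a; change (y (S a)) with
      (if Rlt_dec (f (S a) (2 * y a)%nat) (w (S a))
       then (2 * y a)%nat else (2 * y a + 1)%nat).
    destruct Rlt_dec; auto.
  - induction a as [|a IH]; [exact H0|].
    change (y (S a)) with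
      (if Rlt_dec (f (S a) (2 * y a)%nat) (w (S a))
       then (2 * y a)%nat else (2 * y a + 1)%nat).
    destruct Rlt_dec as [|Hn]; [easy|].
    specialize (HS a (y a) IH); lra.
Qed.

(* [below P l y] counts the marked nodes of generation [a + l] inside [node a y], for any [a]. *)
Definition below (P : nat -> Prop) (l y : nat) : R := count P (y * 2 ^ l) (2 ^ l).

Lemma below_nonneg P l y : 0 <= below P l y.
Proof. apply count_nonneg. Qed.

Lemma below_self P y : P y -> below P 0 y = 1.
Proof. intros H; unfold below; simpl; rewrite Nat.mul_1_r, indicator_true by easy; lra. Qed.

Lemma below_children P l y :
  below P l (2 * y) + below P l (2 * y + 1) = below P (S l) y.
Proof.
  unfold below; replace (2 ^ S l)%nat with (2 ^ l + 2 ^ l)%nat by (simpl; lia).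
  rewrite count_add; f_equal; f_equal; nia.
Qed.


(** * Potentials on the dyadic tree *)

Definition weight (s : R) (a : nat) : R := Rpower ((/2) ^ a) s.

Lemma weight_S s a : weight s (S a) = Rpower 2 (- s) * weight s a.
Proof.
  unfold weight; simpl pow.
  rewrite <- Rpower_mult_distr by (try apply half_pow_pos; lra).
  f_equal; unfold Rpower; rewrite ln_Rinv by lra; f_equal; ring.
Qed.

Lemma weight_add s a l : weight s (a + l) = Rpower 2 (- s) ^ l * weight s a.
Proof.
  induction l as [|l IH]; [rewrite Nat.add_0_r; simpl; ring|].
  rewrite Nat.add_succ_r, weight_S, IH; simpl; ring.
Qed.

Lemma weight_0 s : weight s 0 = 1.
Proof. unfold weight, Rpower; simpl; rewrite ln_1, Rmult_0_r; apply exp_0. Qed.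

Lemma weight_pos s a : 0 < weight s a.
Proof. apply exp_pos. Qed.

Lemma Series_nonneg (a : nat -> R) :
  (forall n, 0 <= a n) -> ex_series a -> 0 <= Series a.
Proof.
  intros H Hex; rewrite <- (Rmult_0_l (Series a)), <- Series_scal_l.
  apply Series_le; [intros n; specialize (H n); lra|exact Hex].
Qed.

Lemma sum_n_nonneg (a : nat -> R) N : (forall n, 0 <= a n) -> 0 <= sum_n a N.
Proof.
  intros H; induction N as [|N IH]; [rewrite sum_O; apply H|].
  rewrite sum_Sn; apply Rplus_le_le_0_compat; auto.
Qed.

Lemma term_le_sum_n (a : nat -> R) n N :
  (forall m, 0 <= a m) -> (n <= N)%nat -> a n <= sum_n a N.
Proof.
  intros H Hn; destruct n as [|n].
  - induction N as [|N IH]; [rewrite sum_O; lra|].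
    rewrite sum_Sn; unfold plus; simpl; generalize (H (S N)) (IH (Nat.le_0_l N)); lra.
  - induction N as [|N IH]; [lia|].
    rewrite sum_Sn; unfold plus; simpl.
    destruct (Nat.eq_dec n N) as [->|].
    + generalize (sum_n_nonneg a N H); lra.
    + generalize (H (S N)) (IH ltac:(lia)); lra.
Qed.

Lemma term_le_Series (a : nat -> R) n :
  (forall m, 0 <= a m) -> ex_series a -> a n <= Series a.
Proof.
  intros H Hex; rewrite (Series_incr_n a (S n)) by (lia || easy).
  rewrite <- sum_n_Reals; simpl pred.
  generalize (term_le_sum_n a n n H (le_n n)).
  assert (0 <= Series (fun k => a (S n + k)%nat)).
  { apply Series_nonneg; [intros; apply H|].
    now apply (ex_series_incr_n a (S n)). }
  lra.
Qed.

(** [V] is the share of the cover in the potential. Each [U n] is replaced by the at most three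
    nodes of comparable length that it meets, each of weight at most [2^s (r n)^s]. By the last
    clause, a node whose potential is below its weight at that generation contains no point of
    [U n]. *)
Lemma cover_weight s (U : nat -> R -> Prop) (r : nat -> R) :
  0 < s ->
  (forall n, 0 < r n <= 1) ->
  (forall n t t', U n t -> U n t' -> Rabs (t' - t) <= r n) ->
  ex_series (fun n => Rpower (r n) s) ->
  3 * Rpower 2 s * Series (fun n => Rpower (r n) s) < 1 ->
  exists (V : nat -> nat -> R),
    V O O < 1 /\
    (forall a y, 0 <= V a y) /\
    (forall a y, V (S a) (2 * y)%nat + V (S a) (2 * y + 1)%nat <= V a y) /\
    (forall n t, U n t -> exists g, forall y, node g y t -> weight s g <= V g y).
Proof.
  intros Hs Hr HU Hex Hlt.
  destruct (choice (fun n g => (/2) ^ S g < r n <= (/2) ^ g)) as [g Hg].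
  { intros n; apply dyadic_scale, Hr. }
  set (touch := fun n x => exists t, node (g n) x t /\ U n t).
  (* The set [U n] is counted only in nodes at least as long as its own dyadic scale. Below that
     scale its term is dropped, so [V] is only subadditive. *)
  set (T := fun a y n => if le_dec a (g n)
                         then below (touch n) (g n - a) y * weight s (g n) else 0).
  assert (Hw : forall n, weight s (g n) <= Rpower 2 s * Rpower (r n) s).
  { intros n.
    assert (H : weight s (S (g n)) <= Rpower (r n) s).
    { apply Rle_Rpower_l; [lra|]; split; [apply half_pow_pos|left; apply Hg]. }
    rewrite weight_S, Rpower_Ropp in H.
    assert (H2 : 0 < Rpower 2 s) by apply exp_pos.
    apply Rmult_le_compat_l with (r := Rpower 2 s) in H; [|lra].
    rewrite <- Rmult_assoc, Rinv_r, Rmult_1_l in H by lra; exact H. }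
  assert (HT0 : forall a y n, 0 <= T a y n).
  { intros a y n; unfold T; destruct le_dec; [|lra].
    apply Rmult_le_pos; [apply below_nonneg|left; apply weight_pos]. }
  assert (HT3 : forall a y n, T a y n <= 3 * Rpower 2 s * Rpower (r n) s).
  { intros a y n.
    apply Rle_trans with (3 * weight s (g n)).
    - unfold T; destruct le_dec.
      + apply Rmult_le_compat_r; [left; apply weight_pos|].
        apply count_clustered; intros x x' _ _ [t [Ht Ut]] [t' [Ht' Ut']].
        apply (node_close (g n) x x' t t' Ht Ht').
        apply Rle_trans with (r n); [now apply HU|apply Hg].
      + generalize (weight_pos s (g n)); lra.
    - generalize (Hw n); lra. }
  assert (Hex3 : ex_series (fun n => 3 * Rpower 2 s * Rpower (r n) s))
    by (exact (ex_series_scal (K := R_AbsRing) (V := R_NormedModule)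
         (3 * Rpower 2 s) (fun n => Rpower (r n) s) Hex)).
  assert (HTex : forall a y, ex_series (T a y)).
  { intros a y; apply (ex_series_le (K := R_AbsRing) (V := R_CompleteNormedModule)
      _ (fun n => 3 * Rpower 2 s * Rpower (r n) s)); [|exact Hex3].
    intros n; change (norm (T a y n)) with (Rabs (T a y n)).
    rewrite Rabs_pos_eq by apply HT0; apply HT3. }
  exists (fun a y => Series (T a y)); repeat split.
  - apply Rle_lt_trans with (2 := Hlt).
    rewrite <- Series_scal_l; apply Series_le; [|exact Hex3].
    intros n; split; [apply HT0|apply HT3].
  - intros a y; apply Series_nonneg; [apply HT0|apply HTex].
  - intros a y; rewrite <- Series_plus by apply HTex.
    apply Series_le; [|apply HTex].
    intros n; split; [apply Rplus_le_le_0_compat; apply HT0|].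
    unfold T; destruct (le_dec (S a) (g n)) as [H|H].
    + destruct (le_dec a (g n)) as [H'|]; [|lia].
      rewrite <- Rmult_plus_distr_r, below_children.
      replace (S (g n - S a)) with (g n - a)%nat by lia; lra.
    + generalize (HT0 a y n); unfold T; lra.
  - intros n t Ut; exists (g n); intros y Hy.
    apply Rle_trans with (T (g n) y n).
    + unfold T; destruct le_dec as [_|]; [|lia].
      rewrite Nat.sub_diag, below_self; [lra|exists t; easy].
    + apply (term_le_Series (T (g n) y)); [apply HT0|apply HTex].
Qed.

(** In the application [B j i] is the set of parameters whose [i]th translate first meets the hole
    at time [j]. The separation factor [2^(p+1)] matches the depth of the potential: when a
    generation of clusters starts to be counted in a node, that node is too short to contain points
    of two clusters with the same [j] and [i]. The inequality on [Rpower 2 (- s)] says that the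
    newly counted clusters cost no more than subdivision gains. *)
Lemma avoiding_point (s q rho : R) (n p : nat) (B : nat -> nat -> R -> Prop)
    (U : nat -> R -> Prop) (r : nat -> R) :
  0 < s -> q < 2 -> 2 <= q ^ 2 -> 1 < q ->
  0 < rho <= (/2) ^ S p ->
  (forall j i t t', (i < n)%nat -> B j i t -> B j i t' ->
     Rabs (t' - t) <= rho / q ^ j \/ 2 ^ S p * (rho / q ^ j) <= Rabs (t' - t)) ->
  1 + 12 * INR n * Rpower 2 (- s) ^ S p <= 2 * Rpower 2 (- s) ->
  (forall n, 0 < r n <= 1) ->
  (forall n t t', U n t -> U n t' -> Rabs (t' - t) <= r n) ->
  ex_series (fun n => Rpower (r n) s) ->
  3 * Rpower 2 s * Series (fun n => Rpower (r n) s) < 1 ->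
  exists t, 0 <= t <= 1 /\ (forall j i, (i < n)%nat -> ~ B j i t) /\ (forall n, ~ U n t).
Proof.
  intros Hs Hq2 Hqq Hq1 Hrho HB Hth Hr HU Hex Hlt.
  destruct (cover_weight s U r Hs Hr HU Hex Hlt) as [V [HV1 [HV0 [HVS HVU]]]].
  set (scale := fun b j => (/2) ^ S b < rho / q ^ j <= (/2) ^ b).
  set (hit := fun b j i x => scale b j /\ exists t, node b x t /\ B j i t).
  set (dead := fun b x => exists i, (i < n)%nat /\ exists j, hit b j i x).
  set (D := fun a y l => below (dead (a + l)%nat) l y * weight s (a + l)).
  set (th := Rpower 2 (- s)) in *.
  assert (Hqj : forall j, 0 < q ^ j) by (intros j; apply pow_lt; lra).
  assert (Hdecr : forall j l, rho / q ^ (j + l) = rho / q ^ j / q ^ l).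
  { intros j l; rewrite pow_add; field; split; apply Rgt_not_eq, Hqj. }
  assert (Hpos : forall j, 0 < rho / q ^ j) by (intros; apply Rdiv_lt_0_compat; [lra|apply Hqj]).
  (* Since [q^2 >= 2], the sizes at times [j] and [j+2] never lie in the same dyadic range. *)
  assert (Htwo : forall b, exists j1, forall j, scale b j -> j = j1 \/ j = S j1).
  { intros b.
    destruct (excluded_middle_informative (exists j, scale b j)) as [[j0 H0]|H0];
      [|exists O; intros j Hj; destruct H0; now exists j].
    assert (Hgap : forall j l, scale b j -> ~ scale b (j + S (S l))%nat).
    { intros j l [_ H1] [H2 _]; rewrite Hdecr in H2.
      assert (2 <= q ^ S (S l)).
      { change (S (S l)) with (2 + l)%nat; rewrite pow_add.
        assert (1 <= q ^ l) by (apply pow_R1_Rle; lra). nra. }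
      apply (Rmult_lt_compat_r (q ^ S (S l)) _ _ (Hqj _)) in H2.
      unfold Rdiv in H2; rewrite Rmult_assoc, Rinv_l, Rmult_1_r in H2
        by (apply Rgt_not_eq, Hqj).
      simpl pow at 1 in H2; generalize (half_pow_pos b); unfold Rdiv in H1; nra. }
    destruct (excluded_middle_informative (exists j, (j < j0)%nat /\ scale b j))
      as [[j1 [Hj1 H1]]|H1].
    - exists j1; intros j Hj.
      destruct (le_lt_dec j j1) as [Hle|Hl].
      + destruct (Nat.eq_dec j j1) as [|]; [now left|].
        destruct (Hgap j (j0 - j - 2)%nat Hj).
        now replace (j + S (S (j0 - j - 2)))%nat with j0 by lia.
      + destruct (Nat.eq_dec j (S j1)) as [|]; [now right|].
        destruct (Hgap j1 (j - j1 - 2)%nat H1).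
        now replace (j1 + S (S (j - j1 - 2)))%nat with j by lia.
    - exists j0; intros j Hj.
      destruct (Nat.eq_dec j j0); [now left|]; destruct (Nat.eq_dec j (S j0)); [now right|].
      destruct (le_lt_dec j j0).
      + destruct H1; exists j; split; [lia|easy].
      + destruct (Hgap j0 (j - j0 - 2)%nat H0).
        now replace (j0 + S (S (j - j0 - 2)))%nat with j by lia. }
  (* Two clusters inside one node of generation [a] would be at distance at least
     [2^(p+1) rho / q^j], which exceeds [2^-a]. So there is only one, of diameter at most
     [2^-(a+p)]. *)
  assert (Hhit : forall a y j i, (i < n)%nat -> below (hit (a + p)%nat j i) p y <= 3).
  { intros a y j i Hi; apply count_clustered.
    intros x x' Hx Hx' [Hsc [t [Ht Bt]]] [_ [t' [Ht' Bt']]].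
    apply (node_close (a + p) x x' t t' Ht Ht').
    apply Rle_trans with (rho / q ^ j); [|apply Hsc].
    destruct (HB j i t t' Hi Bt Bt') as [|Hfar]; [easy|exfalso].
    apply (node_sub a p y x t Hx) in Ht; apply (node_sub a p y x' t' Hx') in Ht'.
    assert (Hd : Rabs (t' - t) <= (/2) ^ a).
    { unfold node in *; apply Rabs_le; lra. }
    destruct Hsc as [Hsc _].
    assert (Hp : (/2) ^ a = 2 ^ S p * (/2) ^ S (a + p)).
    { replace (S (a + p)) with (a + S p)%nat by lia.
      apply half_pow_shift. }
    assert (0 < 2 ^ S p) by (apply pow_lt; lra). nra. }
  (* Three nodes for each of the [n] indices and each of the two possible times. *)
  assert (Hdead : forall a y, below (dead (a + p)%nat) p y <= 6 * INR n).
  { intros a y; rewrite Rmult_comm; destruct (Htwo (a + p)%nat) as [j1 Hj1].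
    apply count_union with (T := fun i x => exists j, hit (a + p)%nat j i x).
    - intros x [i [Hi Hx]]; now exists i.
    - intros i Hi; eapply Rle_trans;
        [apply (count_or _ (hit (a + p)%nat j1 i) (hit (a + p)%nat (S j1) i))|].
      + intros x [j Hj]; destruct (Hj1 j (proj1 Hj)) as [->| ->]; auto.
      + generalize (Hhit a y j1 i Hi) (Hhit a y (S j1) i Hi); unfold below; lra. }
  assert (HD0 : forall a y l, 0 <= D a y l).
  { intros; apply Rmult_le_pos; [apply below_nonneg|left; apply weight_pos]. }
  set (Phi := fun a y => V a y + sum_n (D a y) p).
  destruct (greedy_branch Phi (weight s)) as [y [Hy0 [HyS HyPhi]]].
  - unfold Phi; rewrite weight_0.
    replace (sum_n (D O O) p) with 0; [lra|].
    (* At the root no cluster is counted yet: [rho <= 2^-(p+1)] puts all of them at generation [p+1]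
       or later. *)
    rewrite (sum_n_ext_loc _ (fun _ => 0)).
    + rewrite sum_n_const; symmetry; apply Rmult_0_r.
    + intros l Hl; unfold D; simpl plus; unfold below; rewrite count_zero; [apply Rmult_0_l|].
      intros x _ [i [_ [j [[Hsc _] _]]]].
      assert (Hsm : rho / q ^ j <= rho).
      { rewrite <- (Rdiv_1_r rho) at 2; apply Rmult_le_compat_l; [lra|].
        apply Rinv_le_contravar; [lra|]; apply pow_R1_Rle; lra. }
      change (0 + l)%nat with l in Hsc; destruct Hrho as [_ Hrho].
      assert (S p < S l)%nat; [apply half_pow_antitone; lra|lia].
  - intros a y Hlt'; unfold Phi in *.
    (* Passing to the children moves the window of generations from [a, ..., a+p] to
       [a+1, ..., a+p+1]. The old generation [a] is discarded, and the new one costs at most [6 n]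
       nodes in each child. *)
    assert (E : sum_n (D (S a) (2 * y)%nat) p + sum_n (D (S a) (2 * y + 1)%nat) p
                <= sum_n (D a y) p + 12 * INR n * th ^ S p * weight s a).
    { rewrite <- (sum_n_plus (G := R_AbelianGroup) (D (S a) (2 * y)%nat)).
      assert (EQ : forall l, D (S a) (2 * y)%nat l + D (S a) (2 * y + 1)%nat l = D a y (S l)).
      { intros l; unfold D; rewrite <- Rmult_plus_distr_r, below_children.
        now replace (a + S l)%nat with (S a + l)%nat by lia. }
      rewrite (sum_n_ext _ (fun l => D a y (S l))) by apply EQ.
      assert (Hlast : D a y (S p) <= 12 * INR n * th ^ S p * weight s a).
      { rewrite <- EQ; unfold D; rewrite <- Rmult_plus_distr_r.
        replace (S a + p)%nat with (a + S p)%nat at 3 by lia.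
        rewrite weight_add, <- Rmult_assoc; fold th.
        apply Rmult_le_compat_r; [left; apply weight_pos|].
        apply Rmult_le_compat_r; [left; apply pow_lt, exp_pos|].
        generalize (Hdead (S a) (2 * y)%nat) (Hdead (S a) (2 * y + 1)%nat); lra. }
      assert (Esh : D a y O + sum_n (fun l => D a y (S l)) p = sum_n (D a y) p + D a y (S p)).
      { generalize p; intros N; induction N as [|N IH].
        - rewrite !sum_O; reflexivity.
        - rewrite !sum_Sn; unfold plus; simpl; simpl in IH; lra. }
      generalize (HD0 a y O); lra. }
    generalize (HVS a y); rewrite weight_S; fold th.
    generalize (weight_pos s a); nra.
  - destruct (nested_nodes y Hy0 HyS) as [t Ht]; exists t; repeat split.
    + generalize (Ht O); rewrite Hy0; unfold node; simpl; lra.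
    + generalize (Ht O); rewrite Hy0; unfold node; simpl; lra.
    + intros j i Hi Bt.
      (* At the dyadic scale [b] of the cluster, the node containing [t] would itself be dead, and
         the term [l = 0] alone would reach its full weight. *)
      destruct (dyadic_scale (rho / q ^ j)) as [b Hb]. 
      { split; [apply Hpos|].
        rewrite <- (Rmult_1_r 1); apply Rmult_le_compat.
        - lra.
        - left; apply Rinv_0_lt_compat, Hqj.
        - apply Rle_trans with (1 := proj2 Hrho).
          rewrite <- (pow1 (S p)); apply pow_incr; lra.
        - rewrite <- Rinv_1; apply Rinv_le_contravar; [lra|]; apply pow_R1_Rle; lra. }
      generalize (HyPhi b) (HV0 b (y b)); unfold Phi.
      assert (weight s b <= sum_n (D b (y b)) p); [|lra].
      apply Rle_trans with (D b (y b) O); [|apply term_le_sum_n; [apply HD0|lia]].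
      unfold D; rewrite Nat.add_0_r, below_self; [lra|].
      exists i; split; [easy|]; exists j; split; [easy|]; exists t; split; [apply Ht|easy].
    + intros m Um; destruct (HVU m t Um) as [g Hg].
      generalize (Hg (y g) (Ht g)) (HyPhi g); unfold Phi.
      generalize (sum_n_nonneg (D g (y g)) p (HD0 g (y g))); lra.
Qed.

(** * Lower bounds for the Hausdorff dimension *)

(** The bound [d] keeps the supremum finite: [real] sends an infinite one to 0. *)
Lemma diam_ge (A : R -> Prop) d x y :
  (forall x y, A x -> A y -> Rabs (x - y) <= d) -> A x -> A y -> Rabs (x - y) <= diam A.
Proof.
  intros Hd Ax Ay; unfold diam.
  set (E := fun r => exists x y, A x /\ A y /\ r = Rabs (x - y)).
  destruct (Lub_Rbar_correct E) as [Hub Hlub].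
  assert (H1 : Rbar_le (Rabs (x - y)) (Lub_Rbar E)) by (apply Hub; now exists x, y).
  assert (H2 : Rbar_le (Lub_Rbar E) d)
    by (apply Hlub; intros r [x' [y' [Ax' [Ay' ->]]]]; now apply Hd).
  destruct (Lub_Rbar E); simpl in *; easy.
Qed.

(** For empty [A] the supremum is minus infinity and [diam] is 0, whence [0 <= d]. *)
Lemma diam_nonneg_le (A : R -> Prop) d :
  0 <= d -> (forall x y, A x -> A y -> Rabs (x - y) <= d) -> diam A <= d.
Proof.
  intros Hd0 Hd; unfold diam.
  set (E := fun r => exists x y, A x /\ A y /\ r = Rabs (x - y)).
  destruct (Lub_Rbar_correct E) as [_ Hlub].
  assert (H2 : Rbar_le (Lub_Rbar E) d)
    by (apply Hlub; intros r [x' [y' [Ax' [Ay' ->]]]]; now apply Hd).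
  destruct (Lub_Rbar E); simpl in *; easy.
Qed.

Lemma spow_nonneg d s : 0 <= spow d s.
Proof. unfold spow; destruct Rle_dec; [lra|left; apply exp_pos]. Qed.

Lemma spow_antitone d s s' : d <= 1 -> s <= s' -> spow d s' <= spow d s.
Proof.
  intros Hd Hs; unfold spow; destruct Rle_dec as [|Hn]; [lra|].
  unfold Rpower; destruct (Req_dec d 1) as [->|Hd1].
  - rewrite ln_1, !Rmult_0_r; lra.
  - assert (ln d < 0) by (rewrite <- ln_1; apply ln_increasing; lra).
    destruct (Req_dec s s') as [->|]; [lra|].
    left; apply exp_increasing; nra.
Qed.

Lemma cover_sum_ge s (U : nat -> R -> Prop) N :
  Rbar_le (sum_n (fun n => spow (diam (U n)) s) N) (cover_sum s U).
Proof.
  unfold cover_sum.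
  set (u := fun N => sum_n (fun n => spow (diam (U n)) s) N).
  rewrite <- (Lim_seq_const (u N)); apply Lim_seq_le_loc.
  exists N; intros m Hm; induction Hm as [|m Hm IH]; [apply Rle_refl|].
  unfold u at 2; rewrite sum_Sn; unfold plus; simpl.
  apply Rle_trans with (1 := IH); unfold u.
  generalize (spow_nonneg (diam (U (S m))) s); lra.
Qed.

(** For [s < s0] and diameters at most 1, the [s]-sum dominates the [s0]-sum. Hence no [delta]-cover
    has [s]-sum below [c], the [s]-dimensional measure is at least [c > 0], and [s] is not among the
    exponents whose infimum is the dimension. *)
Lemma hausdorff_dim_ge (A : R -> Prop) (s0 delta c : R) :
  0 < delta <= 1 -> 0 < c ->
  (forall U, delta_cover delta A U ->
     ~ (forall N, sum_n (fun n => spow (diam (U n)) s0) N <= c)) ->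
  Rbar_le s0 (hausdorff_dim A).
Proof.
  intros Hdelta Hc Hcov.
  unfold hausdorff_dim, Rbar_glb.
  destruct Rbar_ex_glb as [gl [Hlb Hglb]]; unfold proj1_sig.
  apply Hglb; intros v [s [Hs [-> HH]]]; simpl.
  destruct (Rle_lt_dec s0 s) as [|Hss]; [easy|exfalso].
  assert (H1 : Rbar_le c (hausdorff_delta s delta A)).
  { unfold hausdorff_delta, Rbar_glb.
    destruct Rbar_ex_glb as [gl' [Hlb' Hglb']]; unfold proj1_sig.
    apply Hglb'; intros v [U [HU <-]].
    destruct (Rbar_le_lt_dec c (cover_sum s U)) as [|Hlt]; [easy|exfalso].
    apply (Hcov U HU); clear Hcov; intros N.
    apply Rle_trans with (sum_n (fun n => spow (diam (U n)) s) N).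
    - assert (Ht : forall n, spow (diam (U n)) s0 <= spow (diam (U n)) s).
      { intros n; apply spow_antitone; [|lra].
        apply Rle_trans with delta; [|lra].
        apply diam_nonneg_le; [lra|]; intros x y; apply (proj2 HU). }
      induction N as [|N IH]; [rewrite !sum_O; apply Ht|].
      rewrite !sum_Sn; apply Rplus_le_compat; auto.
    - generalize (cover_sum_ge s U N); intros H.
      assert (H' := Rbar_le_lt_trans _ _ _ H Hlt); simpl in H'; lra. }
  assert (H2 : Rbar_le (hausdorff_delta s delta A) (hausdorff_measure s A)).
  { unfold hausdorff_measure, Rbar_lub.
    destruct Rbar_ex_lub as [lu [Hub Hlub]]; unfold proj1_sig.
    apply Hub; exists delta; split; [lra|easy]. }
  rewrite HH in H2; assert (H3 := Rbar_le_trans _ _ _ H1 H2); simpl in H3; lra.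
Qed.

Lemma partial_sums_bounded (a : nat -> R) c :
  (forall n, 0 <= a n) -> (forall N, sum_n a N <= c) -> ex_series a /\ Series a <= c.
Proof.
  intros Ha Hc.
  assert (Hinc : forall N, sum_n a N <= sum_n a (S N)).
  { intros N; rewrite sum_Sn; unfold plus; simpl; generalize (Ha (S N)); lra. }
  destruct (ex_finite_lim_seq_incr (sum_n a) c Hinc Hc) as [l Hl].
  split; [exists l; exact Hl|].
  rewrite (is_series_unique a l Hl).
  apply (is_lim_seq_le (sum_n a) (fun _ => c) l c); [easy|exact Hl|apply is_lim_seq_const].
Qed.

(** The powers add up to 1/12. With 1/24 left for the sets of positive diameter the total is 1/8,
    and [3 * 2 * (1/8) < 1]. *)
Lemma summable_sizes s : 0 < s ->
  exists eta : nat -> R, (forall n, 0 < eta n <= 1) /\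
    (forall n, Rpower (eta n) s = / 24 * (/2) ^ n).
Proof.
  intros Hs; exists (fun n => Rpower (/ 24 * (/2) ^ n) (/ s)).
  assert (Hh1 : forall n, 0 < (/2) ^ n <= 1).
  { intros n; split; [apply half_pow_pos|]; rewrite <- (pow1 n); apply pow_incr; lra. }
  split; intros n; generalize (Hh1 n); intros Hn.
  - split; [apply exp_pos|].
    apply Rle_trans with (Rpower 1 (/ s)).
    + apply Rle_Rpower_l; [left; apply Rinv_0_lt_compat|]; lra.
    + unfold Rpower; rewrite ln_1, Rmult_0_r, exp_0; lra.
  - rewrite Rpower_mult, Rinv_l, Rpower_1; lra.
Qed.

Lemma is_series_sizes : is_series (fun n => / 24 * (/2) ^ n) (/ 12).
Proof.
  replace (/ 12) with (/ 24 * / (1 - / 2)) by field.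
  apply (is_series_scal (K := R_AbsRing) (V := R_NormedModule)).
  apply is_series_geom; rewrite Rabs_right; lra.
Qed.

Lemma Rpower_2_le s : s <= 1 -> 0 < Rpower 2 s <= 2.
Proof.
  intros Hs; split; [apply exp_pos|]; apply Rle_trans with (Rpower 2 1);
    [apply Rle_Rpower|rewrite Rpower_1]; lra.
Qed.

(* Sets of diameter [0] contribute nothing to [cover_sum], so they are given summable positive sizes [eta n] before the points are avoided. *)
Lemma hausdorff_dim_ge_of_avoiding (A G : R -> Prop) (s X Lam : R) :
  0 < s <= 1 -> 0 < Lam <= 1 ->
  (forall t, G t -> A (X + Lam * t)) ->
  (forall (U : nat -> R -> Prop) (r : nat -> R),
     (forall n, 0 < r n <= 1) ->
     (forall n t t', U n t -> U n t' -> Rabs (t' - t) <= r n) ->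
     ex_series (fun n => Rpower (r n) s) ->
     3 * Rpower 2 s * Series (fun n => Rpower (r n) s) < 1 ->
     exists t, G t /\ forall n, ~ U n t) ->
  Rbar_le s (hausdorff_dim A).
Proof.
  intros Hs HLam HG Hav.
  assert (HLs : 0 < Rpower Lam s) by apply exp_pos.
  (* Pulling a cover back along [t -> X + Lam t] divides diameters by [Lam]. They become at most 1,
     and their [s]-sum at most 1/24. *)
  apply hausdorff_dim_ge with (delta := Lam) (c := Rpower Lam s / 24); [lra|lra|].
  intros U [Hcov Hdiam] Hsum.
  destruct (summable_sizes s (proj1 Hs)) as [eta [Heta Hetas]].
  set (d := fun n => diam (U n)).
  set (r := fun n => if Rle_dec (d n) 0 then eta n else d n / Lam).
  assert (Hr : forall n, Rpower (r n) s <= spow (d n) s * / Rpower Lam s + / 24 * (/2) ^ n).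
  { intros n; generalize (half_pow_pos n); intros Hn; unfold r, spow; destruct Rle_dec as [|Hd].
    - rewrite Hetas; lra.
    - unfold Rdiv; rewrite <- Rpower_mult_distr by (try apply Rinv_0_lt_compat; lra).
      replace (Rpower (/ Lam) s) with (/ Rpower Lam s); [lra|].
      rewrite <- Rpower_Ropp; unfold Rpower; rewrite ln_Rinv by lra; f_equal; ring. }
  destruct (partial_sums_bounded (fun n => spow (d n) s) (Rpower Lam s / 24)
              (fun n => spow_nonneg _ _) Hsum) as [Hex HS].
  assert (Hex1 : ex_series (fun n => spow (d n) s * / Rpower Lam s))
    by (apply (ex_series_scal_r (/ Rpower Lam s) _ Hex)).
  assert (Hex2 : ex_series (fun n => / 24 * (/2) ^ n))
    by (eexists; apply is_series_sizes).
  assert (Hex12 : ex_series (fun n => spow (d n) s * / Rpower Lam s + / 24 * (/2) ^ n))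
    by (exact (ex_series_plus (K := R_AbsRing) (V := R_NormedModule) _ _ Hex1 Hex2)).
  assert (Hr0 : forall n, 0 <= Rpower (r n) s) by (intros n; left; apply exp_pos).
  assert (Hexr : ex_series (fun n => Rpower (r n) s)).
  { apply (ex_series_le (K := R_AbsRing) (V := R_CompleteNormedModule)
             _ (fun n => spow (d n) s * / Rpower Lam s + / 24 * (/2) ^ n)); [|exact Hex12].
    intros n; change (Rabs (Rpower (r n) s) <= spow (d n) s * / Rpower Lam s + / 24 * (/2) ^ n).
    rewrite Rabs_pos_eq by apply Hr0; apply Hr. }
  destruct (Hav (fun n t => U n (X + Lam * t)) r) as [t [Gt Ht]].
  - intros n; unfold r; destruct Rle_dec as [|Hd]; [apply Heta|].
    split; [apply Rdiv_lt_0_compat; lra|].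
    apply Rmult_le_reg_r with Lam; [lra|]; unfold Rdiv.
    rewrite Rmult_assoc, Rinv_l, Rmult_1_r, Rmult_1_l by lra.
    apply diam_nonneg_le; [lra|apply Hdiam].
  - intros n t t' Ut Ut'.
    assert (HD := diam_ge (U n) Lam _ _ (Hdiam n) Ut' Ut).
    replace (X + Lam * t' - (X + Lam * t)) with (Lam * (t' - t)) in HD by ring.
    rewrite Rabs_mult, (Rabs_right Lam) in HD by lra; fold (d n) in HD.
    generalize (Rabs_pos (t' - t)); intros Hp.
    unfold r; destruct Rle_dec as [Hd|Hd].
    + generalize (Heta n); nra.
    + apply Rmult_le_reg_l with Lam; [lra|].
      unfold Rdiv; rewrite (Rmult_comm (d n)), <- Rmult_assoc, Rinv_r; lra.
  - exact Hexr.
  - assert (HSr : Series (fun n => Rpower (r n) s) <= / 8).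
    { apply Rle_trans with (1 := Series_le _ _ (fun n => conj (Hr0 n) (Hr n)) Hex12).
      rewrite Series_plus by assumption.
      rewrite (Series_scal_r (/ Rpower Lam s) (fun n => spow (d n) s)),
        (is_series_unique _ _ is_series_sizes).
      apply Rmult_le_compat_r with (r := / Rpower Lam s) in HS;
        [|left; now apply Rinv_0_lt_compat].
      replace (Rpower Lam s / 24 * / Rpower Lam s) with (/ 24) in HS by (field; lra).
      lra. }
    generalize (Rpower_2_le s (proj2 Hs)); intros Hp2.
    assert (0 <= Series (fun n => Rpower (r n) s)) by now apply Series_nonneg.
    nra.
  - destruct (Hcov _ (HG t Gt)) as [n Un]; now apply (Ht n).
Qed.

(** * Counting expansions *)

Definition prepend (b : bool) (e : nat -> bool) (n : nat) : bool :=
  match n with O => b | S n => e n end.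

Lemma prepend_eta e : e = prepend (e O) (fun n => e (S n)).
Proof. apply functional_extensionality; now intros [|n]. Qed.

Lemma prepend_inj b b' e e' : prepend b e = prepend b' e' -> b = b' /\ e = e'.
Proof.
  intros H; split; [exact (f_equal (fun f => f O) H)|].
  apply functional_extensionality; intros n; exact (f_equal (fun f => f (S n)) H).
Qed.

Lemma expansion_prepend q x b e : 0 < q ->
  is_expansion q x (prepend b e) <-> is_expansion q (q * x - digit b) e.
Proof.
  intros Hq; unfold is_expansion.
  assert (Hqn : forall n, q ^ n <> 0) by (intros; apply pow_nonzero; lra).
  set (a := fun j => digit (prepend b e j) / q ^ S j).
  assert (Ha0 : a O = digit b / q) by (unfold a; simpl; f_equal; ring).
  assert (HaS : forall j, digit (e j) / q ^ S j = q * a (S j)).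
  { intros j; unfold a; simpl; field; split; [apply Hqn|lra]. }
  split; intros H.
  - apply is_series_ext with (fun j => scal q (a (S j))).
    { intros j; symmetry; apply HaS. }
    replace (q * x - digit b) with (scal q (x - a O))
      by (rewrite Ha0; unfold scal; simpl; unfold mult; simpl; field; lra).
    apply (is_series_scal (K := R_AbsRing) (V := R_NormedModule)).
    apply (is_series_incr_1 (K := R_AbsRing) (V := R_NormedModule)).
    match goal with |- is_series _ ?v => replace v with x end; [exact H|].
    unfold plus; simpl; ring.
  - apply (is_series_decr_1 (K := R_AbsRing) (V := R_NormedModule) a).
    apply is_series_ext with (fun j => scal (/ q) (digit (e j) / q ^ S j)).
    { intros j; rewrite HaS; unfold scal; simpl; unfold mult; simpl; field; lra. }
    match goal with |- is_series _ ?v => replace v with (scal (/ q) (q * x - digit b)) end;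
      [|rewrite Ha0; unfold scal, plus, opp; simpl; unfold mult; simpl; field; lra].
    now apply (is_series_scal (K := R_AbsRing) (V := R_NormedModule)).
Qed.

Lemma digit_bound b : 0 <= digit b <= 1.
Proof. destruct b; simpl; lra. Qed.

Lemma expansion_bounds q x e : 1 < q -> is_expansion q x e -> 0 <= x <= 1 / (q - 1).
Proof.
  intros Hq H; unfold is_expansion in H.
  assert (Hqn : forall n, 0 < q ^ n) by (intros; apply pow_lt; lra).
  assert (Hgeo : is_series (fun j => / q * (/ q) ^ j) (/ q * (/ (1 - / q)))).
  { apply (is_series_scal (K := R_AbsRing) (V := R_NormedModule)).
    apply is_series_geom; rewrite Rabs_right by (left; apply Rinv_0_lt_compat; lra).
    rewrite <- Rinv_1; apply Rinv_lt_contravar; lra. }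
  assert (Hterm : forall j, 0 <= digit (e j) / q ^ S j <= / q * (/ q) ^ j).
  { intros j; rewrite pow_inv, <- Rinv_mult.
    change (q * q ^ j) with (q ^ S j).
    assert (H' := Rinv_0_lt_compat _ (Hqn (S j))).
    generalize (digit_bound (e j)); unfold Rdiv; nra. }
  replace (1 / (q - 1)) with (/ q * (/ (1 - / q))) by (field; lra).
  rewrite <- (is_series_unique _ _ H), <- (is_series_unique _ _ Hgeo); split.
  - rewrite <- (Rmult_0_l (Series (fun j => digit (e j) / q ^ S j))), <- Series_scal_l.
    apply Series_le; [|now exists x].
    intros j; generalize (Hterm j); lra.
  - apply Series_le; [exact Hterm|eexists; exact Hgeo].
Qed.

(** The partial sums are [X 0 - q^-(N+1) X (N+1)], and the remainder vanishes because the orbit is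
    bounded. *)
Lemma expansion_of_orbit q e (X : nat -> R) C : 1 < q ->
  (forall j, 0 <= X j <= C) -> (forall j, X (S j) = q * X j - digit (e j)) ->
  is_expansion q (X O) e.
Proof.
  intros Hq HC HX; unfold is_expansion.
  assert (Hqn : forall n, 0 < q ^ n) by (intros; apply pow_lt; lra).
  assert (Hs : forall N, sum_n (fun j => digit (e j) / q ^ S j) N = X O - (/ q) ^ S N * X (S N)).
  { intros N; rewrite pow_inv; induction N as [|N IH].
    - rewrite sum_O, HX; simpl; field; lra.
    - rewrite sum_Sn, IH, (HX (S N)); unfold plus; simpl.
      generalize (Hqn N); intros; field; split; lra. }
  change (is_lim_seq (sum_n (fun j => digit (e j) / q ^ S j)) (X O)).
  apply is_lim_seq_ext with (fun N => X O - (/ q) ^ S N * X (S N)).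
  { intros N; now rewrite Hs. }
  replace (Finite (X O)) with (Finite (X O - 0)) by (f_equal; ring).
  apply is_lim_seq_minus'; [apply is_lim_seq_const|].
  apply is_lim_seq_le_le with (u := fun _ => 0) (w := fun N => (/ q) ^ S N * C).
  - intros N; assert (0 < (/ q) ^ S N) by (apply pow_lt, Rinv_0_lt_compat; lra).
    generalize (HC (S N)); nra.
  - apply is_lim_seq_const.
  - replace (Finite 0) with (Rbar_mult 0 C) by (simpl; f_equal; ring).
    apply is_lim_seq_scal_r, (is_lim_seq_incr_1 (fun N => (/ q) ^ N)), is_lim_seq_geom.
    rewrite Rabs_right by (left; apply Rinv_0_lt_compat; lra).
    rewrite <- Rinv_1; apply Rinv_lt_contravar; lra.
Qed.

Lemma num_expansions_split q x a b : 0 < q ->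
  num_expansions_eq q (q * x) a -> num_expansions_eq q (q * x - 1) b ->
  num_expansions_eq q x (a + b).
Proof.
  intros Hq [la [<- [Nda Ha]]] [lb [<- [Ndb Hb]]].
  exists (map (prepend false) la ++ map (prepend true) lb); repeat split.
  - now rewrite length_app, !length_map.
  - apply NoDup_app.
    + apply FinFun.Injective_map_NoDup; [|exact Nda].
      intros e e' H; now apply prepend_inj in H.
    + apply FinFun.Injective_map_NoDup; [|exact Ndb].
      intros e e' H; now apply prepend_inj in H.
    + intros e He He'; apply in_map_iff in He as [e1 [<- _]].
      apply in_map_iff in He' as [e2 [H _]]; apply prepend_inj in H; now destruct H.
  - rewrite (prepend_eta e); set (e' := fun n => e (S n)); clearbody e'.
    rewrite expansion_prepend by exact Hq; intros H; apply in_app_iff.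
    destruct (e O); [right|left]; apply in_map.
    + now apply Hb.
    + apply Ha; simpl in H; now rewrite Rminus_0_r in H.
  - intros H; apply in_app_iff in H; destruct H as [H|H];
      apply in_map_iff in H as [e' [<- H]]; apply expansion_prepend; try exact Hq; simpl.
    + rewrite Rminus_0_r; now apply Ha.
    + now apply Hb.
Qed.

Lemma num_expansions_outside q x : 1 < q ->
  x < 0 \/ 1 / (q - 1) < x -> num_expansions_eq q x 0.
Proof.
  intros Hq Hx; exists nil; repeat split; [constructor| |intros []].
  intros H; apply expansion_bounds in H; [lra|exact Hq].
Qed.

Definition step (q c y : R) : R := if Rlt_dec y c then q * y else q * y - 1.

Fixpoint orbit (q c : R) (j : nat) (y : R) : R :=
  match j with O => y | S j => orbit q c j (step q c y) end.

Lemma orbit_S q c j y : orbit q c (S j) y = step q c (orbit q c j y).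
Proof. revert y; induction j as [|j IH]; intros y; [easy|]; simpl in *; now rewrite IH. Qed.

(** The hole [[c, cb]] contains the switch region [[1/q, 1/(q(q-1))]]. Left of it the digit 1 would
    leave a negative tail, right of it the digit 0 a tail above [1/(q-1)], so every digit is forced.
    The orbit itself stays in [I_q] and supplies the expansion. *)
Lemma unique_expansion q c cb y : 1 < q <= 2 ->
  c <= 1 / q -> 1 / (q * (q - 1)) <= cb -> 0 <= y <= 1 / (q - 1) ->
  (forall j, orbit q c j y < c \/ cb < orbit q c j y) ->
  num_expansions_eq q y 1.
Proof.
  intros Hq Hc Hcb Hy Horb.
  assert (Hc' : c * q <= 1).
  { apply Rmult_le_compat_r with (r := q) in Hc; [|lra].
    replace (1 / q * q) with 1 in Hc by (field; lra); exact Hc. }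
  assert (Hcb' : 1 / (q - 1) <= cb * q).
  { apply Rmult_le_compat_r with (r := q) in Hcb; [|lra].
    replace (1 / (q * (q - 1)) * q) with (1 / (q - 1)) in Hcb by (field; lra); exact Hcb. }
  assert (HI : 1 / (q - 1) * (q - 1) = 1) by (field; lra).
  assert (HI1 : 1 <= 1 / (q - 1)).
  { replace 1 with (1 / 1) at 1 by field; apply Rmult_le_compat_l; [lra|].
    apply Rinv_le_contravar; lra. }
  set (dig := fun j => if Rlt_dec (orbit q c j y) c then false else true).
  exists (dig :: nil); repeat split.
  - constructor; [intros []|constructor].
  - intros He; left; apply functional_extensionality; intros j; unfold dig.
    clear dig Hy; revert y e Horb He; induction j as [|j IH]; intros y e Horb He;
      rewrite (prepend_eta e) in He;
      apply expansion_prepend in He; try lra.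
    + apply expansion_bounds in He; [|lra].
      specialize (Horb O); simpl in *.
      destruct Rlt_dec, (e O); simpl in *; try easy; nra.
    + assert (E : q * y - digit (e O) = step q c y).
      { apply expansion_bounds in He; [|lra].
        specialize (Horb O); simpl in *; unfold step.
        destruct Rlt_dec, (e O); simpl in *; try easy; nra. }
      rewrite E in He; simpl.
      apply (IH (step q c y) (fun n => e (S n))); [|exact He].
      intros i; exact (Horb (S i)).
  - intros [<-|[]].
    change y with (orbit q c O y) at 1.
    apply (expansion_of_orbit q dig (fun j => orbit q c j y) (1 / (q - 1)) (proj1 Hq)).
    + induction j as [|j IH]; [exact Hy|].
      rewrite orbit_S; unfold step; specialize (Horb j); destruct Rlt_dec; nra.
    + intros j; rewrite orbit_S; unfold dig, step; destruct Rlt_dec; simpl; lra.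
Qed.

(** The [r] leading zeros are forced: a digit 1 would leave a negative tail. *)
Lemma num_expansions_shrink q z r : 1 < q -> 0 <= z < 1 ->
  num_expansions_eq q z 1 -> num_expansions_eq q (z / q ^ r) 1.
Proof.
  intros Hq Hz Hn; induction r as [|r IH]; [simpl; now rewrite Rdiv_1_r|].
  assert (Hqr : 1 <= q ^ r) by (apply pow_R1_Rle; lra).
  replace 1%nat with (1 + 0)%nat by easy.
  assert (E : q * (z / q ^ S r) = z / q ^ r) by (simpl; field; lra).
  apply num_expansions_split; [lra| |]; rewrite E; [exact IH|].
  apply num_expansions_outside; [exact Hq|left].
  assert (z / q ^ r <= z); [|lra].
  rewrite <- (Rdiv_1_r z) at 2; apply Rmult_le_compat_l; [lra|].
  apply Rinv_le_contravar; lra.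
Qed.

Lemma num_expansions_prepend_ones q u a i : 19 / 10 <= q < 2 -> 1 / q <= u ->
  num_expansions_eq q u a ->
  num_expansions_eq q ((1 - / q ^ i) / (q - 1) + u / q ^ i) a /\
  1 / q <= (1 - / q ^ i) / (q - 1) + u / q ^ i.
Proof.
  intros Hq Hu Hn.
  assert (Hiq : / 2 < / q) by (apply Rinv_lt_contravar; lra).
  assert (HI : 1 / (q - 1) < 3 / 2).
  { apply Rmult_lt_reg_r with (q - 1); [lra|].
    replace (1 / (q - 1) * (q - 1)) with 1 by (field; lra); lra. }
  induction i as [|i [IH1 IH2]].
  - simpl; replace ((1 - / 1) / (q - 1) + u / 1) with u by (field; lra); easy.
  - set (w := (1 - / q ^ i) / (q - 1) + u / q ^ i) in *.
    assert (0 < q ^ i) by (apply pow_lt; lra).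
    replace ((1 - / q ^ S i) / (q - 1) + u / q ^ S i) with ((w + 1) / q)
      by (unfold w; simpl; field; lra).
    split.
    + replace a with (0 + a)%nat by easy.
      assert (E : q * ((w + 1) / q) = w + 1) by (field; lra).
      apply num_expansions_split; [lra| |]; rewrite E.
      * apply num_expansions_outside; [lra|right]; unfold Rdiv in IH2; lra.
      * now replace (w + 1 - 1) with w by ring.
    + apply Rmult_le_compat_r; [lra|]; unfold Rdiv in IH2; lra.
Qed.

(** The shift of the tail after [r] rewritings, [kappa (q^k + q^(2k) + ... + q^(rk))]: one defect
    per block, magnified by the position of that block. *)
Fixpoint drift (q kappa : R) (k r : nat) : R :=
  match r with O => 0 | S r => drift q kappa k r + kappa * q ^ (S r * k) end.

(* [1/q + z'/q^(rk+1)] is the point [1 0^(rk) z'].  Choosing the first digit 0 instead of 1 forces the next [k-1] digits to be 1 and leads to [1 0^((r-1)k) z''], where [z' - z''] comes from the defect [kappa] of the identity between [1] and [1^k]. *)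
Lemma num_expansions_chain q k z n : 19 / 10 <= q < 2 -> (1 <= k)%nat ->
  let kappa := (1 - / q ^ k) / (q - 1) - 1 in
  (forall r, (r <= n)%nat ->
     1 / 8 <= z + drift q kappa k r < 1 /\ num_expansions_eq q (z + drift q kappa k r) 1) ->
  forall r, (r <= n)%nat ->
    num_expansions_eq q (1 / q + (z + drift q kappa k r) / q ^ (r * k + 1)) (r + 1).
Proof.
  intros Hq Hk kappa Hz.
  assert (HI : 1 / (q - 1) < 9 / 8).
  { apply Rmult_lt_reg_r with (q - 1); [lra|].
    replace (1 / (q - 1) * (q - 1)) with 1 by (field; lra); lra. }
  induction r as [|r IH]; intros Hr.
  - destruct (Hz O Hr) as [Hz0 Hn0]; simpl in *; rewrite Rplus_0_r, Rmult_1_r in *.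
    assert (E : q * (1 / q + z / q) = 1 + z) by (field; lra).
    replace 1%nat with (0 + 1)%nat by easy.
    apply num_expansions_split; [lra| |]; rewrite E.
    (* The lower bound 1/8 on the tail makes [1 + z >= 9/8] exceed [1/(q-1)]. *)
    + apply num_expansions_outside; [lra|right; lra].
    + now replace (1 + z - 1) with z by ring.
  - specialize (IH ltac:(lia)).
    set (zr := z + drift q kappa k r) in *.
    destruct (Hz (S r) Hr) as [Hz1 Hn1].
    assert (Hzr : 0 <= zr) by (generalize (Hz r ltac:(lia)); fold zr; lra).
    assert (Hqn : forall i, 0 < q ^ i) by (intros; apply pow_lt; lra).
    assert (Hu : 1 / q <= 1 / q + zr / q ^ (r * k + 1)).
    { assert (0 <= zr / q ^ (r * k + 1)); [|lra].
      apply Rmult_le_pos; [lra|left; apply Rinv_0_lt_compat, Hqn]. }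
    destruct (num_expansions_prepend_ones q _ _ (k - 1) Hq Hu IH) as [Hone _].
    set (z1 := z + drift q kappa k (S r)) in *.
    assert (Ez : z1 = zr + kappa * q ^ (S r * k)) by (unfold z1, zr; simpl; ring).
    assert (E : q * (1 / q + z1 / q ^ (S r * k + 1)) = 1 + z1 / q ^ (S r * k)).
    { rewrite pow_add, pow_1; generalize (Hqn (S r * k)%nat); intros; field; lra. }
    replace (S r + 1)%nat with (r + 1 + 1)%nat by lia.
    apply num_expansions_split; [lra| |]; rewrite E.
    (* First digit 0: the remaining point is [1^(k-1)] followed by the previous point of the chain,
       by the choice of [kappa]. First digit 1, below: zeros followed by [z1], which gives exactly
       one more expansion. *)
    + replace (1 + z1 / q ^ (S r * k)) with
        ((1 - / q ^ (k - 1)) / (q - 1) + (1 / q + zr / q ^ (r * k + 1)) / q ^ (k - 1));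
        [exact Hone|].
      rewrite Ez; unfold kappa.
      destruct k as [|k']; [lia|].
      replace (S k' - 1)%nat with k' by lia.
      replace (S r * S k')%nat with (S (r * S k' + k')) by lia.
      replace (r * S k' + 1)%nat with (S (r * S k')) by lia.
      rewrite <- !tech_pow_Rmult, pow_add.
      generalize (Hqn k') (Hqn (r * S k')%nat); intros; field; lra.
    + replace (1 + z1 / q ^ (S r * k) - 1) with (z1 / q ^ (S r * k)) by ring.
      apply num_expansions_shrink; [lra|lra|exact Hn1].
Qed.

(** * First hits of the hole *)

Fixpoint first_hit (q c cb : R) (j : nat) (y : R) : Prop :=
  match j with
  | O => c <= y <= cb
  | S j => (y < c \/ cb < y) /\ first_hit q c cb j (step q c y)
  end.

Lemma orbit_avoids q c cb y : (forall j, ~ first_hit q c cb j y) ->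
  forall j, orbit q c j y < c \/ cb < orbit q c j y.
Proof.
  intros H j; revert y H; induction j as [|j IH]; intros y H;
    assert (H0 : y < c \/ cb < y) by (specialize (H O); simpl in H; lra).
  - exact H0.
  - apply (IH (step q c y)); intros i Hi; now apply (H (S i)).
Qed.

(* With [Q = q^-k] this is the value of [0 1^(k-1)] in base [q]. *)
Definition hole_l (q Q : R) : R := (1 - q * Q) / (q * (q - 1)).
(** The mirror image of the left end under [x -> 1/(q-1) - x], hence the value of
    [1 0^(k-1) 1 1 1 ...]. *)
Definition hole_r (q Q : R) : R := 1 / (q - 1) - hole_l q Q.

(** With [2 - q] close to [Q] and [q] close to 2, the hole has length about [3Q/2] and lies near
    1/2, whereas the last right-hand side, the value of [11], is near 3/4. *)
Lemma hole_bounds q Q :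
  199 / 100 <= q < 2 -> 0 < Q <= / 1000 -> Rabs (2 - q - Q) <= Q / 4 ->
  hole_l q Q <= 1 / q /\ 1 / (q * (q - 1)) <= hole_r q Q /\
  Q <= hole_r q Q - hole_l q Q <= 2 * Q /\
  hole_r q Q + / 8 <= (1 - / q ^ 2) / (q - 1).
Proof.
  intros Hq HQ HqQ; apply Rabs_le_between in HqQ.
  assert (Hd : 197 / 100 <= q * (q - 1) <= 2) by nra.
  assert (Hw : hole_r q Q - hole_l q Q = (2 * q * Q - (2 - q)) / (q * (q - 1)))
    by (unfold hole_r, hole_l; field; lra).
  repeat split.
  - apply Rmult_le_reg_r with (q * (q - 1)); [lra|]; unfold hole_l.
    replace ((1 - q * Q) / (q * (q - 1)) * (q * (q - 1))) with (1 - q * Q) by (field; lra).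
    replace (1 / q * (q * (q - 1))) with (q - 1) by (field; lra); nra.
  - apply Rmult_le_reg_r with (q * (q - 1)); [lra|]; unfold hole_r, hole_l.
    replace ((1 / (q - 1) - (1 - q * Q) / (q * (q - 1))) * (q * (q - 1)))
      with (q - 1 + q * Q) by (field; lra).
    replace (1 / (q * (q - 1)) * (q * (q - 1))) with 1 by (field; lra); nra.
  - rewrite Hw; apply Rmult_le_reg_r with (q * (q - 1)); [lra|].
    unfold Rdiv; rewrite Rmult_assoc, Rinv_l, Rmult_1_r by lra; nra.
  - rewrite Hw; apply Rmult_le_reg_r with (q * (q - 1)); [lra|].
    unfold Rdiv; rewrite Rmult_assoc, Rinv_l, Rmult_1_r by lra; nra.
  - apply Rmult_le_reg_r with (q * (q * (q - 1))); [nra|]; unfold hole_r, hole_l.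
    replace ((1 / (q - 1) - (1 - q * Q) / (q * (q - 1)) + / 8) * (q * (q * (q - 1))))
      with (q * (q - 1 + q * Q) + q * (q * (q - 1)) / 8) by (field; lra).
    replace ((1 - / q ^ 2) / (q - 1) * (q * (q * (q - 1)))) with (q ^ 2 - 1) by (field; lra).
    nra.
Qed.

(** A point left of the hole is already below the value of [11]. A point right of it takes the digit
    1, which matches the first digit of [1^i], and the comparison passes to the next point and
    [1^(i-1)], the margin being scaled by [1/q]. *)
Lemma first_hit_below_ones q c cb : 1 < q ->
  c <= cb -> cb + / 8 <= (1 - / q ^ 2) / (q - 1) ->
  forall j i y, (j + 2 <= i)%nat -> first_hit q c cb j y ->
  y + / 8 / q ^ j <= (1 - / q ^ i) / (q - 1).
Proof.
  intros Hq Hc Hv.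
  assert (Hqn : forall n, 0 < q ^ n) by (intros; apply pow_lt; lra).
  assert (Hvi : forall i, (2 <= i)%nat -> (1 - / q ^ 2) / (q - 1) <= (1 - / q ^ i) / (q - 1)).
  { intros i Hi; apply Rmult_le_compat_r; [left; apply Rinv_0_lt_compat; lra|].
    assert (/ q ^ i <= / q ^ 2); [|lra].
    apply Rinv_le_contravar; [apply Hqn|]; apply Rle_pow; [lra|exact Hi]. }
  assert (Hj8 : forall j, / 8 / q ^ j <= / 8).
  { intros j; rewrite <- (Rdiv_1_r (/ 8)) at 2; apply Rmult_le_compat_l; [lra|].
    apply Rinv_le_contravar; [lra|]; apply pow_R1_Rle; lra. }
  induction j as [|j IH]; intros i y Hi Hy.
  - generalize (Hvi i ltac:(lia)); simpl in Hy; specialize (Hj8 O); lra.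
  - destruct Hy as [Hout Hy]; generalize (Hvi i ltac:(lia)) (Hj8 (S j)); intros H1 H2.
    destruct Hout as [Hl|Hr]; [lra|].
    destruct i as [|i]; [lia|].
    specialize (IH i (step q c y) ltac:(lia) Hy); unfold step in IH.
    destruct Rlt_dec; [lra|].
    apply Rmult_le_reg_l with q; [lra|].
    replace (q * ((1 - / q ^ S i) / (q - 1))) with ((1 - / q ^ i) / (q - 1) + 1)
      by (simpl; generalize (Hqn i); intros; field; lra).
    replace (q * (y + / 8 / q ^ S j)) with (q * y + / 8 / q ^ j)
      by (simpl; generalize (Hqn j); intros; field; lra).
    lra.
Qed.

(** If both orbits lie on the same side of the hole up to time [j], the distance is that of two
    points of the hole, scaled by [q^-j]. Otherwise they part at some time on opposite sides. The
    left point then steps below [q * hole_l], the value of [1^(k-1)], with the margin of the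
    previous lemma; this is why the hole begins at [0 1^(k-1)]. When too few ones are available for
    that lemma, the length of the hole itself is large enough. *)
Lemma first_hit_separation q k Q : (3 <= k)%nat -> Q = / q ^ k ->
  199 / 100 <= q < 2 -> 0 < Q <= / 1000 -> Rabs (2 - q - Q) <= Q / 4 ->
  forall j y y', first_hit q (hole_l q Q) (hole_r q Q) j y ->
    first_hit q (hole_l q Q) (hole_r q Q) j y' ->
  Rabs (y' - y) <= 2 * Q / q ^ j \/ / 8 / q ^ j <= Rabs (y' - y).
Proof.
  intros Hk HQk Hq HQ HqQ.
  destruct (hole_bounds q Q Hq HQ HqQ) as [_ [_ [Hw Hv]]].
  assert (Ec : q * hole_l q Q = (1 - / q ^ (k - 1)) / (q - 1)).
  { unfold hole_l; rewrite HQk; destruct k as [|k]; [lia|].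
    replace (S k - 1)%nat with k by lia; simpl.
    assert (0 < q ^ k) by (apply pow_lt; lra); field; lra. }
  set (c := hole_l q Q) in *; set (cb := hole_r q Q) in *.
  assert (Hqn : forall n, 0 < q ^ n) by (intros; apply pow_lt; lra).
  assert (Hdiv : forall x j, q * (x / q ^ S j) = x / q ^ j).
  { intros x j; simpl; generalize (Hqn j); intros; field; lra. }
  assert (Hcross : forall j y y', y < c -> cb < y' -> first_hit q c cb j (step q c y) ->
                     / 8 / q ^ S j <= y' - y).
  { intros j y y' Hy Hy' Hh; unfold step in Hh; destruct Rlt_dec; [|lra].
    apply Rmult_le_reg_l with q; [lra|]; rewrite Hdiv.
    destruct (le_lt_dec (j + 2) (k - 1)) as [Hj|Hj].
    - apply (first_hit_below_ones q c cb) with (i := (k - 1)%nat) in Hh; try lra; try lia.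
      rewrite <- Ec in Hh; nra.
    - apply Rle_trans with (q * Q); [|nra].
      rewrite HQk; destruct k as [|[|k]]; [lia|lia|].
      assert (/ q ^ j <= / q ^ k).
      { apply Rinv_le_contravar; [apply Hqn|]; apply Rle_pow; [lra|lia]. }
      assert (0 < / q ^ k) by apply Rinv_0_lt_compat, Hqn.
      assert (/ 2 <= / q) by (apply Rinv_le_contravar; lra).
      replace (q * / q ^ S (S k)) with (/ q * / q ^ k)
        by (simpl; generalize (Hqn k); intros; field; lra).
      unfold Rdiv; nra. }
  induction j as [|j IH]; intros y y' Hy Hy'.
  - left; simpl in *; rewrite Rdiv_1_r; apply Rabs_le; lra.
  - destruct Hy as [Ho Hy]; destruct Hy' as [Ho' Hy'].
    specialize (IH _ _ Hy Hy').
    assert (Hsame : step q c y' - step q c y = q * (y' - y) ->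
       Rabs (y' - y) <= 2 * Q / q ^ S j \/ / 8 / q ^ S j <= Rabs (y' - y)).
    { intros E; rewrite E, Rabs_mult, (Rabs_right q) in IH by lra.
      destruct IH as [IH|IH]; [left|right]; apply Rmult_le_reg_l with q;
        rewrite ?Hdiv; lra. }
    destruct Ho as [Ho|Ho], Ho' as [Ho'|Ho'].
    + apply Hsame; unfold step; do 2 (destruct Rlt_dec; [|lra]); ring.
    + right; apply Rle_trans with (y' - y); [now apply Hcross|apply Rle_abs].
    + right; rewrite Rabs_minus_sym.
      apply Rle_trans with (y - y'); [now apply Hcross|apply Rle_abs].
    + apply Hsame; unfold step; do 2 (destruct Rlt_dec; [lra|]); ring.
Qed.

(** * Estimates near the k-Bonacci number *)

Lemma bernoulli x M : -1 <= x -> 1 + INR M * x <= (1 + x) ^ M.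
Proof.
  intros Hx; induction M as [|M IH]; [simpl; lra|].
  rewrite S_INR, <- tech_pow_Rmult.
  apply Rle_trans with ((1 + x) * (1 + INR M * x)).
  - generalize (pos_INR M); nra.
  - apply Rmult_le_compat_l; lra.
Qed.

(** Summing the geometric series gives [q^k (2 - q) = 1]. Keeping only the three top terms gives
    [q^3 >= q^2 + q + 1], which fails below 9/5. *)
Lemma bonacci_gap k q : (4 <= k)%nat -> is_k_bonacci k q ->
  9 / 5 <= q < 2 /\ 2 - q = / q ^ k.
Proof.
  intros Hk [Hq H].
  assert (Hqk : forall i, 0 < q ^ i) by (intros; apply pow_lt; lra).
  repeat split; [|lra|].
  - destruct k as [|[|[|[|k]]]]; try lia.
    replace (S (S (S (S k))) - 1)%nat with (S (S (S k))) in H by lia.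
    assert (Hs : 0 <= sum_f_R0 (fun i => q ^ i) k)
      by (apply cond_pos_sum; intros; left; apply Hqk).
    simpl in H; assert (q * q ^ k > 0) by (generalize (Hqk k); nra).
    assert (q ^ 3 >= q ^ 2 + q + 1) by (simpl; nra).
    nra.
  - rewrite tech3 in H by lra; replace (S (k - 1)) with k in H by lia.
    specialize (Hqk k); apply Rmult_eq_reg_r with (q ^ k); [|lra].
    rewrite Rinv_l by lra.
    assert (q ^ k * (1 - q) = 1 - q ^ k) by (rewrite H at 1; field; lra).
    lra.
Qed.

(** As [a >= 1], one has [b >= a - d >= (1 - d) a]; then Bernoulli's inequality applies. *)
Lemma pow_ratio_ge a b d M : 1 <= a -> 0 < b -> Rabs (a - b) <= d -> d <= 1 ->
  (1 - INR M * d) * a ^ M <= b ^ M.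
Proof.
  intros Ha Hb Hd Hd1; apply Rabs_le_between in Hd.
  apply Rle_trans with ((1 + - d) ^ M * a ^ M).
  - apply Rmult_le_compat_r; [apply pow_le; lra|].
    generalize (bernoulli (- d) M ltac:(lra)); lra.
  - rewrite <- Rpow_mult_distr; apply pow_incr; nra.
Qed.

Lemma drift_bound q kappa k r : 0 < q -> 2 <= q ^ k ->
  Rabs (drift q kappa k r) <= 2 * Rabs kappa * q ^ (r * k).
Proof.
  intros Hq Hqk; generalize (Rabs_pos kappa); intros Hkap.
  induction r as [|r IH].
  - simpl; rewrite Rabs_R0; lra.
  - cbn [drift]; eapply Rle_trans; [apply Rabs_triang|].
    replace (S r * k)%nat with (k + r * k)%nat by lia; rewrite pow_add.
    assert (Hp : 0 < q ^ (r * k)) by now apply pow_lt.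
    rewrite Rabs_mult, (Rabs_right (q ^ k * _)) by nra.
    assert (0 <= Rabs kappa * q ^ (r * k)) by nra; nra.
Qed.

(** With [W = qk^k] and [V = qk^((m+1)k)] the hypothesis reads [d < 1 / (V W qk^3)]. The defect
    [kappa = (2 - q - Q)/(q - 1)] is at most [3 d] because [2 - qk = 1/W], and the largest drift is
    at most [12 d V], which is small since [W] is large. *)
Lemma near_bonacci m k qk q :
  (30 <= k)%nat -> is_k_bonacci k qk ->
  Rabs (q - qk) < Rpower qk (- INR ((m + 2) * k + 3)) ->
  let Q := / q ^ k in
  19999 / 10000 <= q < 2 /\ 0 < Q <= / 1000000 /\ Rabs (2 - q - Q) <= Q / 4 /\
  forall r, (r <= m + 1)%nat -> Rabs (drift q ((1 - Q) / (q - 1) - 1) k r) <= / 8.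
Proof.
  intros Hk Hb Hd Q.
  destruct (bonacci_gap k qk ltac:(lia) Hb) as [Hqk Hgap].
  assert (Hpk : forall i, 1 <= qk ^ i) by (intros; apply pow_R1_Rle; lra).
  rewrite Rpower_Ropp, Rpower_pow, pow_add in Hd by lra.
  replace ((m + 2) * k)%nat with (S m * k + k)%nat in Hd by lia.
  rewrite pow_add in Hd.
  set (d := Rabs (q - qk)) in *.
  set (W := qk ^ k) in *.
  set (V := qk ^ (S m * k)) in *.
  assert (HW : 10000000 <= W).
  { apply Rle_trans with ((9 / 5) ^ 30); [simpl; lra|].
    apply Rle_trans with (qk ^ 30); [apply pow_incr; lra|].
    apply Rle_pow; [lra|exact Hk]. }
  assert (HVW : W <= V) by (unfold V, W; apply Rle_pow; [lra|simpl; lia]).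
  (* This absorbs the linear factors [M d] of Bernoulli's inequality into [d W] and [d V]. *)
  assert (Hlin : forall M, INR M <= 5 / 4 * qk ^ M).
  { intros M; generalize (bernoulli (4 / 5) M ltac:(lra)); intros H1.
    assert ((1 + 4 / 5) ^ M <= qk ^ M) by (apply pow_incr; lra).
    generalize (pos_INR M); lra. }
  assert (Hd0 : 0 <= d) by apply Rabs_pos.
  assert (HdVW : d * (V * W) <= / 5).
  { assert (5 <= qk ^ 3) by (simpl; nra).
    assert (HVWp : 0 < V * W) by nra.
    apply Rmult_le_reg_r with 5; [lra|].
    apply Rle_trans with (d * (V * W * qk ^ 3)); [assert (0 <= d * (V * W)) by nra; nra|].
    assert (0 < V * W * qk ^ 3) by nra.
    apply Rle_trans with (/ (V * W * qk ^ 3) * (V * W * qk ^ 3)).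
    - apply Rmult_le_compat_r; lra.
    - rewrite Rinv_l; lra. }
  assert (HdV : d * V <= / 50000000) by (assert (0 <= d * V) by nra; nra).
  assert (HdW : d * W <= / 50000000) by nra.
  assert (Hdsmall : d <= / 50000000) by nra.
  assert (HWgap : (2 - qk) * W = 1) by (rewrite Hgap; apply Rinv_l; lra).
  assert (Hdd : Rabs (q - qk) <= d) by (unfold d; lra).
  assert (Hdd' : Rabs (qk - q) <= d) by (rewrite Rabs_minus_sym; exact Hdd).
  assert (Hq : 19999 / 10000 <= q < 2).
  { apply Rabs_le_between in Hdd; split; [nra|].
    assert (d < 2 - qk); [|lra].
    apply Rmult_lt_reg_r with W; lra. }
  assert (HQ0 : 0 < q ^ k) by (apply pow_lt; lra).
  assert (HQk : Q * q ^ k = 1) by (apply Rinv_l; lra).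
  assert (HQpos : 0 < Q) by (apply Rinv_0_lt_compat; lra).
  assert (Hkd : INR k * d <= 5 / 4 * W * d)
    by (apply Rmult_le_compat_r; [lra|apply Hlin]).
  assert (H1 : (1 - INR k * d) * W <= q ^ k) by (apply pow_ratio_ge; lra).
  assert (H2 : (1 - INR k * d) * q ^ k <= W) by (apply pow_ratio_ge; lra).
  assert (Hkd0 : 0 <= INR k * d) by (generalize (pos_INR k); nra).
  assert (HP : 9 / 10 * W <= q ^ k) by nra.
  assert (HMd : INR (S m * k) * d <= 5 / 4 * V * d)
    by (apply Rmult_le_compat_r; [lra|apply Hlin]).
  assert (H3 : (1 - INR (S m * k) * d) * q ^ (S m * k) <= V) by (apply pow_ratio_ge; lra).
  assert (Hdiff : Rabs (2 - qk - Q) <= 3 / 2 * d).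
  { set (e := INR k * d) in *.
    assert (HQW1 : 1 - e <= Q * W) by (rewrite <- HQk; nra).
    assert (HQW2 : (1 - e) * (Q * W) <= 1) by (rewrite <- HQk; nra).
    assert (HQW3 : Q * W <= 101 / 100) by nra.
    apply Rabs_le; split; apply Rmult_le_reg_r with W; nra. }
  assert (Hmain : Rabs (2 - q - Q) <= 5 / 2 * d).
  { apply Rabs_le_between in Hdiff, Hdd; apply Rabs_le; lra. }
  repeat split; try lra.
  - apply Rmult_le_reg_r with (q ^ k); [lra|]; nra.
  - apply Rle_trans with (1 := Hmain).
    apply Rmult_le_reg_r with (q ^ k); [lra|]. 
    assert (d * q ^ k <= / 100) by nra.  nra.
  - intros r Hr; set (kappa := (1 - Q) / (q - 1) - 1).
    assert (Hkap : Rabs kappa <= 3 * d).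
    { replace kappa with ((2 - q - Q) / (q - 1)) by (unfold kappa; field; lra).
      unfold Rdiv; rewrite Rabs_mult, (Rabs_right (/ (q - 1)))
        by (left; apply Rinv_0_lt_compat; lra).
      apply Rmult_le_reg_r with (q - 1); [lra|].
      rewrite Rmult_assoc, Rinv_l by lra; nra. }
    apply Rle_trans with (2 * Rabs kappa * q ^ (r * k)); [apply drift_bound; lra|].
    assert (q ^ (r * k) <= q ^ (S m * k)) by (apply Rle_pow; [lra|nia]).
    assert (0 < q ^ (r * k)) by (apply pow_lt; lra).
    assert (q ^ (S m * k) <= 2 * V) by nra.
    apply Rle_trans with (2 * (3 * d) * (2 * V)); [|lra].
    generalize (Rabs_pos kappa); intros.
    apply Rmult_le_compat; lra.
Qed.

(** * The dimension defect and the branching inequality *)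

(** In logarithms, [K_real] and [2^24 <= 1.999^25] give [1024 n^(20/19) 1.999^(4-k) <= 2^-14], with
    [n = m+2]. The surplus [ln q - ln 1.999 >= 1/2500] improves this by a factor [1 + (k-4)/2500],
    which is what bounds [k E]. *)
Lemma dimension_defect m k q :
  K_real m <= INR k -> 19999 / 10000 <= q < 2 ->
  let E := 1024 * Rpower (INR (m + 2)) (20 / 19) * Rpower q (4 - INR k) in
  0 < E <= / 2 /\ INR k * E <= 1 /\ 15000 * INR (m + 2) * / q ^ k <= E.
Proof.
  intros HK Hq E.
  set (n := INR (m + 2)) in *.
  assert (Hn : 2 <= n) by (unfold n; rewrite plus_INR; simpl; generalize (pos_INR m); lra).
  assert (HKn : 20 / 19 * (ln n / ln (1999 / 1000) + 24) + 4 <= INR k).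
  { replace n with (INR m + 2) by (unfold n; rewrite plus_INR; simpl; lra); exact HK. }
  set (a := ln (1999 / 1000)) in *.
  assert (Hln2 : / 2 <= ln 2) by (generalize ln_lt_2; lra).
  assert (Ha : 24 * ln 2 <= 25 * a).
  { unfold a; replace 24 with (INR 24) by (simpl; lra); replace 25 with (INR 25) by (simpl; lra).
    rewrite <- !ln_pow by lra.
    apply ln_le; [apply pow_lt; lra|simpl; lra]. }
  assert (Hlnn : 0 <= ln n) by (rewrite <- ln_1; apply ln_le; lra).
  assert (Hk1 : 20 / 19 * ln n + 25 * a <= (INR k - 4) * a).
  { apply Rle_trans with ((20 / 19 * (ln n / a + 24)) * a); [|nra].
    replace (20 / 19 * (ln n / a + 24) * a) with (20 / 19 * ln n + 480 / 19 * a)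
      by (field; lra); lra. }
  assert (Hk4 : 0 <= INR k - 4).
  { assert (0 <= ln n / a) by (apply Rmult_le_pos; [lra|left; apply Rinv_0_lt_compat; lra]); lra. }
  assert (Hlq : / 2500 <= ln q - a).
  { unfold a; rewrite <- ln_div by lra; rewrite <- (ln_exp (/ 2500)).
    apply ln_le; [apply exp_pos|].
    assert (H := exp_ineq1_le (- / 2500)); rewrite exp_Ropp in H.
    assert (H0 := exp_pos (/ 2500)).
    apply Rmult_le_compat_r with (r := exp (/ 2500)) in H; [|lra].
    rewrite Rinv_l in H by lra; lra. }
  assert (HE : E * (1 + (INR k - 4) / 2500) <= / 16384).
  { apply Rle_trans with (E * exp ((INR k - 4) * (ln q - a))).
    - apply Rmult_le_compat_l.
      + unfold E; repeat apply Rmult_le_pos; try (left; apply exp_pos); lra.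
      + eapply Rle_trans; [|apply exp_ineq1_le]; nra.
    - unfold E, Rpower.
      replace 1024 with (exp (10 * ln 2)).
      2: { replace 10 with (INR 10) by (simpl; lra); rewrite <- ln_pow, exp_ln by (try apply pow_lt; lra).
           simpl; lra. }
      replace (/ 16384) with (exp (- (14 * ln 2))).
      2: { rewrite exp_Ropp; f_equal.
           replace 14 with (INR 14) by (simpl; lra); rewrite <- ln_pow, exp_ln by (try apply pow_lt; lra).
           simpl; lra. }
      rewrite <- !exp_plus.
      assert (Hle : forall x y, x <= y -> exp x <= exp y).
      { intros x y [H| ->]; [left; now apply exp_increasing|lra]. }
      apply Hle; lra. }
  assert (HE0 : 0 < E).
  { unfold E; repeat apply Rmult_lt_0_compat; try apply exp_pos; lra. }
  assert (HEq : E = 1024 * Rpower n (20 / 19) * (q ^ 4 * / q ^ k)).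
  { unfold E; f_equal; unfold Rminus; rewrite Rpower_plus, Rpower_Ropp, Rpower_pow by lra.
    f_equal; replace 4 with (INR 4) by (simpl; lra); apply Rpower_pow; lra. }
  assert (HE' : 0 <= E * (INR k - 4)) by (apply Rmult_le_pos; lra).
  split; [lra|split; [lra|]].
  rewrite HEq.
  assert (Hnn : n <= Rpower n (20 / 19)).
  { rewrite <- (Rpower_1 n) at 1 by lra; apply Rle_Rpower; lra. }
  assert (Hq4 : 15 <= q ^ 4).
  { assert (399 / 100 <= q * q) by nra; simpl; nra. }
  assert (0 < / q ^ k) by (apply Rinv_0_lt_compat, pow_lt; lra).
  apply Rle_trans with (1024 * n * (15 * / q ^ k)); [assert (0 < n * / q ^ k) by nra; lra|].
  apply Rmult_le_compat; [lra|lra|lra|apply Rmult_le_compat_r; lra].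
Qed.

(** Here [2 * Rpower 2 (-(1-E)) = 2^E >= 1 + E/2], while [p + 1 <= k] and [k E <= 1] give
    [2^(E(p+1)) <= 2]. The cost is thus at most [768 n q^-k], against a gain of at least
    [7500 n q^-k]. *)
Lemma branching_inequality n k q E p :
  0 <= INR n -> 0 < E -> q <= 2 -> 0 < q -> INR k * E <= 1 ->
  15000 * INR n * / q ^ k <= E ->
  (/2) ^ S p < 32 * / q ^ k <= (/2) ^ p ->
  1 + 12 * INR n * Rpower 2 (- (1 - E)) ^ S p <= 2 * Rpower 2 (- (1 - E)).
Proof.
  intros Hn HE Hq2 Hq HkE HnE [Hp1 Hp2].
  assert (Hqk : 0 < q ^ k) by now apply pow_lt.
  assert (Hpk : (S p <= k)%nat).
  { apply (half_pow_antitone k p).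
    assert (Hk : (/2) ^ k <= / q ^ k).
    { rewrite pow_inv; apply Rinv_le_contravar; [exact Hqk|]; apply pow_incr; lra. }
    assert (0 < / q ^ k) by now apply Rinv_0_lt_compat.
    lra. }
  assert (Eth : Rpower 2 (- (1 - E)) = / 2 * Rpower 2 E).
  { replace (- (1 - E)) with (- (1) + E) by ring.
    rewrite Rpower_plus, Rpower_Ropp, Rpower_1; lra. }
  assert (H2E : Rpower 2 E ^ S p <= 2).
  { rewrite <- Rpower_pow, Rpower_mult by apply exp_pos.
    apply Rle_trans with (Rpower 2 1); [|rewrite Rpower_1; lra].
    apply Rle_Rpower; [lra|].
    apply le_INR in Hpk; nra. }
  assert (H1E : 1 + E / 2 <= Rpower 2 E).
  { unfold Rpower; eapply Rle_trans; [|apply exp_ineq1_le].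
    generalize ln_lt_2; nra. }
  rewrite Eth, Rpow_mult_distr.
  assert (Hpos : 0 < Rpower 2 E ^ S p) by (apply pow_lt, exp_pos).
  assert (H : (/2) ^ S p * Rpower 2 E ^ S p <= 32 * / q ^ k * 2).
  { apply Rmult_le_compat; try lra; left; apply half_pow_pos. }
  assert (0 <= INR n * / q ^ k) by (apply Rmult_le_pos; [lra|left; now apply Rinv_0_lt_compat]).
  apply Rmult_le_compat_l with (r := 12 * INR n) in H; [|lra].
  lra.
Qed.

(** * The family of points with [m+2] expansions *)

Theorem theoremA (m k : nat) (qk q : R) :
  K_real m <= INR k ->
  is_k_bonacci k qk ->
  Rabs (q - qk) < Rpower qk (- INR ((m + 2) * k + 3)) ->
  in_B (m + 2) q /\
  Rbar_le (Finite (1 - 1024 * Rpower (INR (m + 2)) (20 / 19) * Rpower q (4 - INR k)))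
          (hausdorff_dim (U_q q (m + 2))) /\
  0 < 1 - 1024 * Rpower (INR (m + 2)) (20 / 19) * Rpower q (4 - INR k).
Proof.
  intros HK Hb Hd.
  assert (Hk : (30 <= k)%nat).
  { assert (0 <= ln (INR m + 2) / ln (1999 / 1000)).
    { apply Rmult_le_pos.
      - rewrite <- ln_1; apply ln_le; [lra|]; generalize (pos_INR m); lra.
      - left; apply Rinv_0_lt_compat; rewrite <- ln_1; apply ln_increasing; lra. }
    unfold K_real in HK.
    assert (INR 29 < INR k) by (simpl INR; lra).
    now apply INR_lt. }
  destruct (near_bonacci m k qk q Hk Hb Hd) as [Hq [HQ [HqQ Hdrift]]].
  destruct (dimension_defect m k q HK Hq) as [HE [HkE HnE]].
  set (E := 1024 * Rpower (INR (m + 2)) (20 / 19) * Rpower q (4 - INR k)) in *.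
  set (Q := / q ^ k) in *.
  set (kappa := (1 - Q) / (q - 1) - 1) in *.
  set (c := hole_l q Q); set (cb := hole_r q Q).
  assert (Hq' : 199 / 100 <= q < 2) by lra.
  assert (HQ' : 0 < Q <= / 1000) by lra.
  assert (Hqn : forall i, 0 < q ^ i) by (intros; apply pow_lt; lra).
  (* With drifts at most 1/8, all tails stay in [[1/8, 7/8]] for [t] in [[0,1]]. *)
  set (zeta := fun i t => / 4 + / 2 * t + drift q kappa k i).
  set (G := fun t => 0 <= t <= 1 /\
              forall j i, (i < m + 2)%nat -> ~ first_hit q c cb j (zeta i t)).
  set (M := ((m + 1) * k + 1)%nat).
  set (X := 1 / q + (/ 4 + drift q kappa k (m + 1)) / q ^ M).
  set (Lam := / 2 / q ^ M).
  assert (HG : forall t, G t -> U_q q (m + 2) (X + Lam * t)).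
  { intros t [Ht Havoid].
    assert (Hz : forall i, (i <= m + 1)%nat -> 1 / 8 <= zeta i t < 1).
    { intros i Hi; specialize (Hdrift i Hi); apply Rabs_le_between in Hdrift.
      unfold zeta; lra. }
    assert (Hnum : num_expansions_eq q (X + Lam * t) (m + 2)).
    { replace (X + Lam * t) with
        (1 / q + (/ 4 + / 2 * t + drift q kappa k (m + 1)) / q ^ ((m + 1) * k + 1))
        by (unfold X, Lam, M, Rdiv; ring).
      replace (m + 2)%nat with (m + 1 + 1)%nat by lia.
      apply (num_expansions_chain q k (/ 4 + / 2 * t) (m + 1) ltac:(lra) ltac:(lia)); [|lia].
      intros r Hr; split; [now apply Hz|].
      destruct (hole_bounds q Q Hq' HQ' HqQ) as [Hc [Hcb _]].
      apply (unique_expansion q c cb); [lra|exact Hc|exact Hcb| |].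
      - specialize (Hz r Hr); unfold zeta in Hz.
        assert (1 <= 1 / (q - 1)); [|fold Q kappa; lra].
        apply Rmult_le_reg_r with (q - 1); [lra|].
        replace (1 / (q - 1) * (q - 1)) with 1 by (field; lra); lra.
      - apply orbit_avoids; intros j; apply Havoid; lia. }
    split; [|exact Hnum].
    destruct Hnum as [l [Hlen [_ Hl]]]; destruct l as [|e l]; [simpl in Hlen; lia|].
    apply (expansion_bounds q _ e); [lra|]; apply Hl; now left. }
  (* In the parameter [t] distances double, so clusters have size [4Q/q^j] and separation [q^-j/4].
     Then [32 Q <= 2^-p] is exactly [2^(p+1) * 4Q <= 1/4]. *)
  destruct (dyadic_scale (32 * Q)) as [p Hp]; [lra|].
  assert (Havoid : forall (U : nat -> R -> Prop) (r : nat -> R),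
     (forall n, 0 < r n <= 1) ->
     (forall n t t', U n t -> U n t' -> Rabs (t' - t) <= r n) ->
     ex_series (fun n => Rpower (r n) (1 - E)) ->
     3 * Rpower 2 (1 - E) * Series (fun n => Rpower (r n) (1 - E)) < 1 ->
     exists t, G t /\ forall n, ~ U n t).
  { intros U r Hr HU Hex HS.
    destruct (avoiding_point (1 - E) q (4 * Q) (m + 2) p
                (fun j i t => first_hit q c cb j (zeta i t)) U r) as [t [Ht [Hav HtU]]];
      try assumption; [lra|lra|nra|lra| | | |].
    - simpl; lra.
    - intros j i t t' _ Bt Bt'.
      destruct (first_hit_separation q k Q ltac:(lia) eq_refl Hq' HQ' HqQ j _ _ Bt Bt')
        as [Hs|Hs]; unfold zeta in Hs;
        match type of Hs with context [Rabs ?v] =>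
          replace v with (/ 2 * (t' - t)) in Hs by ring end;
        rewrite Rabs_mult, (Rabs_right (/ 2)) in Hs by lra.
      + left; unfold Rdiv in *; lra.
      + right.
        assert (Hp2 : 2 ^ S p * (4 * Q) <= / 4).
        { assert (H1 : (/2) ^ p * 2 ^ p = 1).
          { rewrite <- Rpow_mult_distr; replace (/ 2 * 2) with 1 by lra; apply pow1. }
          assert (0 < 2 ^ p) by (apply pow_lt; lra); simpl; nra. }
        assert (0 < / q ^ j) by (apply Rinv_0_lt_compat, Hqn).
        unfold Rdiv in *; rewrite <- Rmult_assoc.
        apply Rle_trans with (/ 4 * / q ^ j); [apply Rmult_le_compat_r; lra|lra].
    - apply (branching_inequality (m + 2) k q); try assumption; try lra; apply pos_INR.
    - exists t; repeat split; try lra; auto. }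
  assert (HLam : 0 < Lam <= 1).
  { assert (1 <= q ^ M) by (apply pow_R1_Rle; lra).
    unfold Lam; split; [apply Rdiv_lt_0_compat; lra|].
    apply Rmult_le_reg_r with (q ^ M); [lra|].
    unfold Rdiv; rewrite Rmult_assoc, Rinv_l; lra. }
  split; [|split; [|lra]].
  - split; [lra|].
    (* Nonemptiness is the case of a cover by empty sets, to which positive sizes are still
       assigned. *)
    destruct (summable_sizes (1 - E)) as [eta [Heta Hetas]]; [lra|].
    assert (Hser : is_series (fun n => Rpower (eta n) (1 - E)) (/ 12))
      by (apply is_series_ext with (2 := is_series_sizes); intros n; symmetry; apply Hetas).
    destruct (Havoid (fun _ _ => False) eta) as [t [Gt _]]; auto; try easy.
    + eexists; exact Hser.
    + rewrite (is_series_unique _ _ Hser); generalize (Rpower_2_le (1 - E)); lra.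
    + exists (X + Lam * t); now apply HG.
  - apply (hausdorff_dim_ge_of_avoiding _ G (1 - E) X Lam); auto; lra.
Qed.
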